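(* For every integer $m\ge0$ and every positive integer $s$ there is a constant $c(m,s)>0$, depending only on $m$ and $s$ (in particular not on the dimension $n$), such that for every $n\ge1$, every $r>1$, every convex body $V\subset B(0,1)\subset\mathbb{R}^n$ and every $f\in\mathcal{O}_r$, $$\left(\frac{1}{|V|}\int_V|f(x)|^s\,dx\right)^{1/s}\le c\big(\widetilde d_f(r),s\big)\,\frac{1}{|V|}\int_V|f(x)|\,dx,$$ where $\widetilde d_f(r)$ is the smallest integer $\ge d_f(r)$.
   Context: $B_c(0,\rho)\subset\mathbb{C}^n$ denotes the open complex Euclidean ball of radius $\rho$ centered at $0$; $B(0,1)=B_c(0,1)\cap\mathbb{R}^n$ is the real Euclidean unit ball; $\mathcal{O}_r$ is the set of holomorphic functions on $B_c(0,r)$. A convex body is a bounded convex subset of $\mathbb{R}^n$ with nonempty interior. $|V|$ is the $n$-dimensional Lebesgue measure of $V$. Chebyshev degree: for $f\in\mathcal{O}_r$, $d_f(r)$ is the best constant $d$ (the infimum of all $d>0$) such that $\sup_I|f|\le\left(\frac{4|I|}{|\omega|}\right)^{d}\sup_\omega|f|$ for every real straight line $l_x\subset\mathbb{C}^n=\mathbb{R}^{2n}$ passing through a point $x\in B_c(0,1)$, every interval $I\subset l_x\cap B_c(0,1)$ and every measurable $\omega\subset I$ of positive length (here $|\cdot|$ is one-dimensional Lebesgue measure). Such a finite $d$ exists for every $f\in\mathcal{O}_r$. *)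

(* Defs.v *)
From HB Require Import structures.
From mathcomp Require Import all_boot all_order all_algebra.
From mathcomp Require Import all_classical all_reals all_analysis.
From mathcomp Require Import complex.

Set Implicit Arguments.
Unset Strict Implicit.
Unset Printing Implicit Defensive.
Import Order.TTheory GRing.Theory Num.Theory numFieldNormedType.Exports.
Local Open Scope classical_set_scope.
Local Open Scope ring_scope.
Local Open Scope complex_scope.

Section LebesgueProd.
Context {R : realType}.
Local Notation RT := (measurableTypeR R).
Local Open Scope ereal_scope.

Definition cons_pair n (p : (RT * n.-tuple RT)%type) : n.+1.-tuple RT :=
  [tuple of p.1 :: p.2].

(* The n-fold product of the one-dimensional Lebesgue measure, on Borel sets. *)
Fixpoint lebesgue_prod (n : nat) : set (n.-tuple RT) -> \bar R :=
  match n with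
  | 0%N => dirac ([tuple] : 0.-tuple RT)
  | n'.+1 => pushforward (lebesgue_measure \x @lebesgue_prod n') (@cons_pair n')
  end.
Arguments lebesgue_prod : clear implicits.

Lemma measurable_cons_pair n : measurable_fun [set: (RT * n.-tuple RT)%type] (@cons_pair n).
Proof. by apply: measurable_cons; [exact: measurable_fst|exact: measurable_snd]. Qed.

Lemma pushforward_cons_sigma_finite n
    (m : set (RT * n.-tuple RT)%type -> \bar R) :
  sigma_finite setT m -> sigma_finite setT (pushforward m (@cons_pair n)).
Proof.
move=> [F FT Fm].
pose g (t : n.+1.-tuple RT) : (RT * n.-tuple RT)%type := (thead t, [tuple of behead t]).
have mg : measurable_fun setT g.
  apply/measurable_fun_pairP; split.
    exact: (@measurable_tnth _ RT n.+1 ord0).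
  exact: measurable_behead.
have gK p : g (cons_pair p) = p.
  by case: p => x t; rewrite /g /cons_pair; congr pair => //; exact: val_inj.
exists (fun k => g @^-1` F k).
  by rewrite -preimage_bigcup -FT preimage_setT.
move=> k; have [mF Foo] := Fm k; split.
  by rewrite -[X in measurable X]setTI; exact: mg.
rewrite /pushforward -comp_preimage (_ : g \o _ = id) ?preimage_id//.
exact/funext/gK.
Qed.

Lemma lebesgue_prodP n :
  exists m : {sigma_finite_measure set (n.-tuple RT) -> \bar R},
    lebesgue_prod n = m.
Proof.
elim: n => [|n [m mE]]; first by exists (dirac ([tuple] : 0.-tuple RT)).
pose pm := Measure.class (measure_function_pushforward__canonical__measure_function_Measure
  (lebesgue_measure \x m) (@measurable_cons_pair n)).
pose pc : {measure set (n.+1.-tuple RT) -> \bar R} := Measure.Pack pm.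
have pf : sigma_finite setT (lebesgue_measure \x m).
  (* the sigma-finiteness instance of the product is shadowed in inference by
     the one for probability measures *)
  exact: (isSigmaFinite.sigma_finiteT
    (lebesgue_integral_fubini.measure_function_Measure_isSigmaFinite__to__measure_function_isSigmaFinite
      lebesgue_measure m)).
pose ps := @Measure_isSigmaFinite.Build _ _ _ pc
  (pushforward_cons_sigma_finite pf).
pose P : {sigma_finite_measure set (n.+1.-tuple RT) -> \bar R} :=
  HB.pack (Measure.sort pc) pc ps.
by exists P; rewrite /= mE.
Qed.

Let lebesgue_prod0 n : lebesgue_prod n set0 = 0.
Proof. by have [m ->] := lebesgue_prodP n; exact: measure0. Qed.

Let lebesgue_prod_ge0 n A : 0 <= lebesgue_prod n A.
Proof. by have [m ->] := lebesgue_prodP n; exact: measure_ge0. Qed.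

Let lebesgue_prod_sigma_additive n : semi_sigma_additive (lebesgue_prod n).
Proof. by have [m ->] := lebesgue_prodP n; exact: measure_semi_sigma_additive. Qed.

HB.instance Definition _ n := isMeasure.Build _ _ _ (lebesgue_prod n)
  (@lebesgue_prod0 n) (@lebesgue_prod_ge0 n) (@lebesgue_prod_sigma_additive n).

Let lebesgue_prod_sigma_finite n : sigma_finite setT (lebesgue_prod n).
Proof. by have [m ->] := lebesgue_prodP n; exact: sigma_finiteT. Qed.

HB.instance Definition _ n := Measure_isSigmaFinite.Build _ _ _ (lebesgue_prod n)
  (@lebesgue_prod_sigma_finite n).

(* The complete n-dimensional Lebesgue measure: a convex body need not be Borel,
   but it is always Lebesgue measurable. *)
Definition lebesgue_tuple n := @completed_measure_extension _ _ _ (lebesgue_prod n).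
Arguments lebesgue_tuple : clear implicits.

HB.instance Definition _ n := Measure.on (lebesgue_tuple n).

HB.instance Definition _ n := Measure_isSigmaFinite.Build _ _ _ (lebesgue_tuple n)
  (completed_measure_extension_sigma_finite (@lebesgue_prod_sigma_finite n)).

End LebesgueProd.
Arguments lebesgue_prod : clear implicits.
Arguments lebesgue_tuple : clear implicits.

Section RealSpace.
Context {R : realType} {n : nat}.
Implicit Types (V : set 'rV[R]_n) (g : 'rV[R]_n -> R).

(* R^n is 'rV[R]_n (which carries the linear structure and the topology), while
   the library puts the product sigma-algebra on tuples; the two are identified
   coordinatewise. *)
Definition rV_of_tuple (t : n.-tuple R) : 'rV[R]_n := \row_i tnth t i.

Definition volume V : \bar R := lebesgue_tuple R n (rV_of_tuple @^-1` V).

(* (1 / |V|) \int_V g(x) dx *)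
Definition average V g : R :=
  (fine (volume V))^-1 *
  (\int[lebesgue_tuple R n]_(t in rV_of_tuple @^-1` V) g (rV_of_tuple t)).

Definition convex_body V := [/\ bounded_set V, convex_set V & V° !=set0].

End RealSpace.

Section ComplexSpace.
Context {R : realType} {n : nat}.
Local Notation normc := (@ComplexField.Normc.normc R).
Implicit Types (z : 'rV[R[i]]_n) (f : 'rV[R[i]]_n -> R[i]).

(* The library norm on 'rV is the sup norm. *)
Definition euclid_norm z : R := Num.sqrt (\sum_(i < n) normc (z 0 i) ^+ 2).

(* B_c(0, rho) *)
Definition cball (rho : R) : set 'rV[R[i]]_n := [set z | euclid_norm z < rho].

Definition rV_complex (x : 'rV[R]_n) : 'rV[R[i]]_n := map_mx (real_complex R) x.

(* Membership in O_r: [differentiable] is Frechet differentiability over R[i];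
   the values of f outside B_c(0, r) are irrelevant. *)
Definition holomorphic_on_ball (r : R) f :=
  let E : normedModType R[i] := 'rV[R[i]]_n in
  forall z : E, cball r z -> differentiable (f : E -> R[i]^o) z.

Definition sup_norm (E : set 'rV[R[i]]_n) f : \bar R :=
  ereal_sup [set (normc (f z))%:E | z in E].

(* The real line through x with unit direction v; t |-> line_at x v t is an
   isometry, so lengths on the line are lengths of parameter sets. *)
Definition line_at (x v : 'rV[R[i]]_n) (t : R) : 'rV[R[i]]_n := x + t%:C *: v.

Local Notation len := (@completed_lebesgue_measure R).

Definition chebyshev_ineq f (d : R) :=
  forall x v : 'rV[R[i]]_n, cball 1 x -> euclid_norm v = 1 ->
  forall I omega : set R,
    is_interval I -> line_at x v @` I `<=` cball 1 ->
    (wlength idfun)^*%mu.-cara.-measurable omega ->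
    omega `<=` I -> (0 < len omega)%E ->
  (sup_norm (line_at x v @` I) f <=
   ((4 * fine (len I) / fine (len omega)) `^ d)%:E *
   sup_norm (line_at x v @` omega) f)%E.

(* d_f(r) for f in O_r; it depends on r only through the domain of f. It is
   finite for every such f, which is a theorem and not part of the definition:
   the infimum is taken in \bar R so that no value is invented for it here. *)
Definition chebyshev_degree f : \bar R :=
  ereal_inf [set d%:E | d in [set d : R | 0 < d /\ chebyshev_ineq f d]].

End ComplexSpace.

Definition is_smallest_int_ge {R : realType} (d : \bar R) (m : int) :=
  (d <= (m%:~R)%:E)%E /\ forall k : int, (d <= (k%:~R)%:E)%E -> m <= k.

(* Main.v *)
Require Import Defs.
From mathcomp Require Import all_boot all_order all_algebra.
From mathcomp Require Import all_classical all_reals all_analysis.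
From mathcomp Require Import complex.
From mathcomp Require Import measurable_realfun ring lra.

Set Implicit Arguments.
Unset Strict Implicit.
Unset Printing Implicit Defensive.
Import Order.TTheory GRing.Theory Num.Theory numFieldNormedType.Exports.
Local Open Scope classical_set_scope.
Local Open Scope ring_scope.
Local Open Scope complex_scope.

(** The averages over V are compared by a dimension-free transport argument, in
    the form of an averaged variant of the Prekopa-Leindler inequality.  Write
    x_t = (1 - t) x + t y, and let dt be Lebesgue measure on a part of [0, 1].
    If f, g, h are nonnegative functions on R^n and

      c <= \int h(x_t) f(x)^-(1-t) g(y)^-t dt    whenever f(x) > 0 and g(y) > 0,

    then  c <= (\int h) \int (\int f)^-(1-t) (\int g)^-t dt.  Unlike the usual
    inequality, it asks for an estimate on average over t only, and this is what
    a one-dimensional Chebyshev inequality delivers.  The hypothesis and the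
    conclusion have the same shape (once h may depend on t), so Tonelli reduces
    the statement to n = 1, where f and g are matched by their mass: where both
    are constant, the matching is affine and the claim is the weighted
    arithmetic-geometric mean inequality [averaged_prekopa_interval]; step
    functions are handled by cutting both at the same fraction of their mass
    [averaged_prekopa_seq], and [averaged_prekopa_grid] is the n-dimensional
    statement for step functions on a grid.

    Let phi be |f| divided by its average over V, and let d = m + 1, which
    exceeds the Chebyshev degree.  On the segment from x to y in V the set where
    phi < phi(x) / L has measure at most 1 / (4s) when L = (16 s)^d
    [chebyshev_segment].  Take dt on the window 1/(2s) <= 1 - t <= 1/s, of length
    1/(2s), and use phi, phi^s 1_{phi > 1} and 1_V for h, f and g: since
    phi(x)^(s(1-t)) <= phi(x) in the window, the hypothesis holds with
    c = 1 / (4 s L); since 1 - t >= 1/(2s) there, the conclusion bounds the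
    average of phi^s 1_{phi > 1} by (4L)^(2s) [truncated_moment_le].  Hence
    c(m,s) = 1 + (4L)^(2s) works in every dimension.

    Passing from step functions to phi uses only lower semicontinuity: the
    infima of phi over the cells of finer and finer grids give a step function
    below phi whose integrals tend to the integral of phi [near_grid_sum_gt].
    This is applied on the interior of V; the boundary is null because V is
    contained in slight dilations of its interior
    [lebesgue_tuple_convex_boundary]. *)

(** * Affine changes of variable on the line *)

Section OneDimensional.
Context {R : realType}.
Local Notation RT := (measurableTypeR R).
Local Notation mu := (@lebesgue_measure R).

Lemma measurable_affine (a b : R) : measurable_fun setT (fun u : RT => (a * u + b : RT)).
Proof. by apply: measurable_funD => //; apply: measurable_funM. Qed.

Lemma lebesgue_measure_affine (a b : R) (A : set R) : 0 < a -> measurable (A : set RT) ->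
  mu A = (a%:E * mu ((fun u : R => (a * u + b)%R) @^-1` A))%E.
Proof.
move=> a0 mA.
pose nu : {measure set RT -> \bar R} :=
  mscale (NngNum (ltW a0)) (pushforward mu (fun u : RT => (a * u + b : RT))).
have mf := measurable_affine a b.
rewrite (_ : (a%:E * _)%E = nu mf A) //.
apply: lebesgue_measure_unique => // _ [[x y]] _ <-.
rewrite /nu/= /mscale /= /pushforward.
rewrite (_ : _ @^-1` _ = `](x - b) / a, (y - b) / a]%classic); last first.
  apply/seteqP; split => u /=; rewrite !in_itv/= ltr_pdivrMr// ler_pdivlMr//.
    by rewrite ltrBlDr lerBrDr mulrC.
  by rewrite ltrBlDr lerBrDr mulrC.
rewrite !lebesgue_measure_itv/= !lte_fin ltr_pM2r ?invr_gt0// ltrD2r.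
case: ifPn => _; last by rewrite mule0.
rewrite -!EFinD -EFinM; congr EFin; field; lra.
Qed.

Lemma ge0_integral_affine (a b : R) (f : R -> \bar R) : 0 < a ->
  measurable_fun [set: RT] f -> (forall x, 0 <= f x)%E ->
  (\int[mu]_z f z = a%:E * \int[mu]_u f (a * u + b)%R)%E.
Proof.
move=> a0 mf f0; have ma := measurable_affine a b.
pose nu : {measure set RT -> \bar R} :=
  mscale (NngNum (ltW a0)) (pushforward mu (fun u : RT => (a * u + b : RT))).
rewrite (_ : (\int[mu]_z f z = \int[nu ma]_z f z)%E); last first.
  apply: eq_measure_integral => A mA _.
  exact: (lebesgue_measure_affine b a0 mA).
rewrite /nu ge0_integral_mscale//= ge0_integral_pushforward//.
Qed.

End OneDimensional.

(** * Weighted arithmetic and geometric means *)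

Definition lerp {R : realType} (t a b : R) : R := (1 - t) * a + t * b.

(** For positive a and b this is a^(1-t) b^t; the exponential form is smooth in t
    and multiplicative in (a, b). *)
Definition gmean {R : realType} (t a b : R) : R := expR ((1 - t) * ln a + t * ln b).

Section Means.
Context {R : realType}.
Local Notation RT := (measurableTypeR R).
Implicit Types t a b c d : R.

Lemma gmean_gt0 t a b : 0 < gmean t a b.
Proof. exact: expR_gt0. Qed.

Lemma gmeanM t a b c d : 0 < a -> 0 < b -> 0 < c -> 0 < d ->
  gmean t (a * c) (b * d) = gmean t a b * gmean t c d.
Proof.
move=> a0 b0 c0 d0; rewrite /gmean -expRD !lnM ?posrE//; congr expR; ring.
Qed.

Lemma gmeanxx t a : 0 < a -> gmean t a a = a.
Proof. by move=> a0; rewrite /gmean -mulrDl subrK mul1r lnK ?posrE. Qed.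

Lemma gmean_le_lerp t a b : 0 <= t <= 1 -> 0 < a -> 0 < b -> gmean t a b <= lerp t a b.
Proof.
move=> /andP[t0 t1] a0 b0.
have := @concave_ln R (Itv01 t0 t1) _ _ b0 a0.
rewrite !convRE/= /unstable.onem => h.
rewrite /gmean /lerp.
have p0 : 0 < (1 - t) * a + t * b.
  case: (ltrP t 1) => t1'; last by have -> : t = 1; lra.
  have : 0 < (1 - t) * a by apply: mulr_gt0 => //; lra.
  by have : 0 <= t * b by [apply: mulr_ge0 => //; lra]; lra.
rewrite -[leRHS]lnK ?posrE// ler_expR.
by rewrite addrC [(1 - t) * a + _]addrC.
Qed.

Lemma le_gmean t a b c d : 0 <= t <= 1 -> 0 < a -> 0 < b -> a <= c -> b <= d ->
  gmean t a b <= gmean t c d.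
Proof.
move=> /andP[t0 t1] a0 b0 ac bd; rewrite ler_expR lerD// ler_wpM2l ?subr_ge0//.
  by rewrite ler_ln// posrE (lt_le_trans a0).
by rewrite ler_ln// posrE (lt_le_trans b0).
Qed.

Lemma measurable_gmeanV a b :
  measurable_fun [set: RT] (fun t : RT => ((gmean t a b)^-1 : RT)).
Proof.
under eq_fun do rewrite /gmean -expRN.
apply: measurableT_comp => //; apply: measurableT_comp => //.
by apply: measurable_funD; apply: measurable_funM => //; apply: measurable_funB.
Qed.

Lemma lerp_affine t a b l m u :
  lerp t (a + u * l) (b + u * m) = lerp t l m * u + lerp t a b.
Proof. rewrite /lerp; ring. Qed.

Lemma lerp_lt t a b c d : 0 <= t <= 1 -> a < c -> b < d -> lerp t a b < lerp t c d.
Proof.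
move=> /andP[t0 t1] ac bd; rewrite /lerp.
have [->|tn0] := eqVneq t 0; first lra.
have tp : 0 < t by rewrite lt_neqAle eq_sym tn0.
by rewrite ler_ltD ?ler_wpM2l ?ltr_pM2l// ?subr_ge0// ltW.
Qed.

Lemma lerp_le t a b c d : 0 <= t <= 1 -> a <= c -> b <= d -> lerp t a b <= lerp t c d.
Proof. by move=> /andP[t0 t1] ac bd; rewrite lerD// ler_wpM2l// subr_ge0. Qed.

End Means.

(** * The averaged Prekopa-Leindler inequality on the line *)

Section OneDim.
Context {R : realType}.
Local Notation RT := (measurableTypeR R).
Local Notation mu := (@lebesgue_measure R).
Local Open Scope ereal_scope.

(** Two constant densities, alpha on [a, a + l) and beta on [b, b + m), which carry
    the same fraction theta of total masses F and G.  For fixed t, the map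
    u |-> (1 - t) (a + u l) + t (b + u m) has derivative (1 - t) l + t m, which by
    the arithmetic-geometric mean inequality is at least
    l^(1-t) m^t = theta F^(1-t) G^t / (alpha^(1-t) beta^t).  So the change of
    variable turns the integral over z into an integral over u in [0, 1) of
    quantities bounded by the hypothesis. *)
Lemma averaged_prekopa_interval (h : RT * RT -> \bar R) (a l alpha b m beta F G theta c : R) :
  measurable_fun setT h -> (forall p, 0 <= h p) ->
  (forall t z, ~~ (0 <= t <= 1)%R -> h (t, z) = 0) ->
  (0 <= c)%R -> (0 < l)%R -> (0 < m)%R -> (0 < alpha)%R -> (0 < beta)%R ->
  (0 < F)%R -> (0 < G)%R -> (0 < theta)%R ->
  (alpha * l = theta * F)%R -> (beta * m = theta * G)%R ->
  (forall x y, (a <= x < a + l)%R -> (b <= y < b + m)%R ->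
    c%:E <= \int[mu]_t ((gmean t alpha beta)^-1%:E * h (t, lerp t x y))) ->
  (theta * c)%:E <= \int[mu]_t ((gmean t F G)^-1%:E * \int[mu]_z h (t, z)).
Proof.
move=> mh h0 h01 c0 l0 m0 al0 be0 F0 G0 th0 eF eG hyp.
pose I := `[0%R, 1%R[%classic : set RT.
pose k (p : RT * RT) : \bar R :=
  ((\1_I p.2)%:E * (theta%:E * ((gmean p.1 alpha beta)^-1%:E *
     h (p.1, lerp p.1 (a + p.2 * l) (b + p.2 * m)))))%E.
have mlerp : measurable_fun setT (fun p : RT * RT =>
    (p.1, lerp p.1 (a + p.2 * l) (b + p.2 * m)) : RT * RT).
  apply: measurable_fun_pair => //=; rewrite /lerp.
  apply: measurable_funD; apply: measurable_funM => //.
  - exact: measurable_funB.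
  - by apply: measurable_funD => //; apply: measurable_funM.
  - by apply: measurable_funD => //; apply: measurable_funM.
have mg al be : measurable_fun setT (fun p : RT * RT => (gmean p.1 al be)^-1%:E).
  by apply/measurable_EFinP; apply: (measurableT_comp (measurable_gmeanV al be)).
have mk : measurable_fun setT k.
  rewrite /k; apply: emeasurable_funM.
    apply/measurable_EFinP; apply: (@measurableT_comp _ _ _ _ _ _ (\1_I : RT -> R)) => //.
    by apply: measurable_indic; exact: measurable_itv.
  apply: (emeasurable_funM (f := cst theta%:E)) => //.
  apply: emeasurable_funM => //.
  exact: (measurableT_comp mh mlerp).
have gV0 t al be : 0 <= (gmean t al be)^-1%:E :> \bar R.
  by rewrite lee_fin invr_ge0 ltW// gmean_gt0.
have k0 p : 0 <= k p.
  apply: mule_ge0; first by rewrite lee_fin.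
  by apply: mule_ge0; [rewrite lee_fin ltW|apply: mule_ge0].
have mht t : measurable_fun setT (fun z : RT => h (t, z)).
  exact: (measurableT_comp mh (pair1_measurable t)).
have mhs t a' b' : measurable_fun [set: RT] (fun u : RT => h (t, (a' * u + b')%R)).
  exact: (measurableT_comp (mht t) (measurable_affine a' b')).
(* For fixed t: change of variable, then restriction of u to [0, 1). *)
have step t : \int[mu]_u k (t, u) <= (gmean t F G)^-1%:E * \int[mu]_z h (t, z).
  case: (boolP (0 <= t <= 1)%R) => t01; last first.
    rewrite (_ : \int[mu]_u k (t, u) = 0); last first.
      by apply: integral0_eq => u _; rewrite /k/= h01// !mule0.
    by apply: mule_ge0 => //; apply: integral_ge0.
  set s := lerp t l m.
  have s0 : (0 < s)%R by apply: lt_le_trans (gmean_gt0 t l m) _; apply: gmean_le_lerp.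
  rewrite [X in _ <= _ * X](ge0_integral_affine (lerp t a b) s0)//.
  rewrite muleA -EFinM -ge0_integralZl//=; last first.
    by rewrite lee_fin mulr_ge0// ?ltW// invr_gt0 gmean_gt0.
  apply: ge0_le_integral => //.
  - exact: (measurableT_comp mk (pair1_measurable t)).
  - exact: emeasurable_funM.
  move=> u _; rewrite /k /= lerp_affine -/s.
  rewrite indicE; case: (u \in I) => /=; last first.
    by rewrite mul0e mule_ge0// lee_fin mulr_ge0// ?ltW// invr_gt0 gmean_gt0.
  rewrite mul1e muleA -EFinM; apply: lee_wpmul2r => //.
  rewrite lee_fin.
  rewrite ler_pdivrMr ?gmean_gt0// -mulrA ler_pdivlMl ?gmean_gt0//.
  have le1 := gmean_le_lerp t01 l0 m0; rewrite -/s in le1.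
  have e : (theta * gmean t F G = gmean t l m * gmean t alpha beta)%R.
    rewrite -{1}(gmeanxx t th0) -gmeanM// -eF -eG [RHS]mulrC; exact: gmeanM.
  by rewrite mulrC e ler_wpM2r// ltW// gmean_gt0.
have outer : \int[mu]_t \int[mu]_u k (t, u) <=
    \int[mu]_t ((gmean t F G)^-1%:E * \int[mu]_z h (t, z)).
  apply: ge0_le_integral => //.
  - by move=> t _; apply: integral_ge0.
  - exact: measurable_fun_fubini_tonelli_F.
  - apply: emeasurable_funM; last exact: measurable_fun_fubini_tonelli_F.
    by apply/measurable_EFinP; exact: measurable_gmeanV.
apply: le_trans outer; rewrite fubini_tonelli//.
have mI : measurable I by exact: measurable_itv.
have -> : (theta * c)%:E = \int[mu]_(u in I) (theta * c)%:E.
  rewrite integral_cst//= lebesgue_measure_itv/= lte_fin ltr01.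
  by rewrite oppr0 adde0 mule1.
rewrite integral_mkcond; apply: ge0_le_integral => //.
- by move=> u _; rewrite patchE; case: ifP => // _; rewrite lee_fin mulr_ge0// ltW.
- by apply/(measurable_restrictT _ _).1.
- exact: measurable_fun_fubini_tonelli_G.
move=> u _; rewrite patchE; case: ifPn => uI; last by apply: integral_ge0.
move: (uI); rewrite inE /I/= in_itv/= => /andP[u0 u1].
rewrite /k/= indicE uI EFinM.
under eq_integral do rewrite mul1e.
rewrite ge0_integralZl//=.
- apply: lee_wpmul2l; first by rewrite lee_fin ltW.
  by apply: hyp; nra.
- apply: emeasurable_funM.
    by apply/measurable_EFinP; exact: measurable_gmeanV.
  exact: (measurableT_comp mh (measurableT_comp mlerp (pair2_measurable u))).
- by move=> t _; apply: mule_ge0.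
- by rewrite lee_fin ltW.
Qed.

End OneDim.

Section Pieces.
Context {R : realType}.
Implicit Types (p q : R * R * R) (L : seq (R * R * R)).

(** A triple (a, l, alpha) stands for the constant value alpha on [a, a + l), and a
    list of triples for the step function made of these pieces from left to
    right. *)
Definition piece p : pred R := fun x => p.1.1 <= x < p.1.1 + p.1.2.

Definition step_seq L :=
  all (fun p => (0 < p.1.2) && (0 < p.2)) L &&
  pairwise (fun p q => p.1.1 + p.1.2 <= q.1.1) L.

Definition mass L : R := \sum_(p <- L) p.2 * p.1.2.

(** Removing from p :: L the part of mass p.2 * l on the left of p; the test avoids
    leaving an empty piece when p is removed entirely. *)
Definition cut_head p L (l : R) :=
  if l < p.1.2 then (p.1.1 + l, p.1.2 - l, p.2) :: L else L.

Lemma mass_cut_head p L l : 0 < l <= p.1.2 ->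
  mass (cut_head p L l) = mass (p :: L) - p.2 * l.
Proof.
move=> /andP[l0 lp]; rewrite /cut_head /mass big_cons; case: ltrP => lp'.
  by rewrite big_cons/=; ring.
by rewrite (_ : l = p.1.2); [ring|apply/le_anti/andP].
Qed.

Lemma step_seq_cut_head p L l : 0 < l <= p.1.2 ->
  step_seq (p :: L) -> step_seq (cut_head p L l).
Proof.
move=> /andP[l0 lp]; rewrite /step_seq/= => /andP[/andP[/andP[p1 p2] aL] /andP[pL pwL]].
rewrite /cut_head; case: ifP => lp'/=; last by rewrite aL.
rewrite (_ : p.1.1 + l + (p.1.2 - l) = p.1.1 + p.1.2); last by ring.
by rewrite subr_gt0 lp' p2 aL pwL pL.
Qed.

Lemma piece_cut_head p L l q x : 0 < l <= p.1.2 -> step_seq (p :: L) ->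
  q \in cut_head p L l -> piece q x ->
  p.1.1 + l <= x /\ exists q', [/\ q' \in p :: L, q'.2 = q.2 & piece q' x].
Proof.
move=> /andP[l0 lp]; rewrite /step_seq/= => /andP[_ /andP[/allP pL _]].
have inL : q \in L -> piece q x ->
  p.1.1 + l <= x /\ exists q', [/\ q' \in p :: L, q'.2 = q.2 & piece q' x].
  move=> qL qx; split; last by exists q; split => //; rewrite inE qL orbT.
  by move: qx (pL _ qL) => /andP[+ _]; lra.
rewrite /cut_head; case: ifP => // lp'; rewrite inE => /predU1P[->|//].
rewrite /piece/= => /andP[x1 x2]; split => //.
by exists p; split; rewrite ?mem_head//; apply/andP; split; lra.
Qed.

Lemma size_cut_head p L l : (size (cut_head p L l) <= (size L).+1)%N.
Proof. by rewrite /cut_head; case: ifP. Qed.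

Lemma size_cut_head_full p L l : l = p.1.2 -> size (cut_head p L l) = size L.
Proof. by move=> ->; rewrite /cut_head ltxx. Qed.

End Pieces.

Section OneDimSeq.
Context {R : realType}.
Local Notation RT := (measurableTypeR R).
Local Notation mu := (@lebesgue_measure R).
Local Open Scope ereal_scope.

(** The monotone transport between two step functions, done by bisection: cut both
    at the same fraction tau of mass, tau being as large as the two leading
    pieces permit, so that at least one piece disappears.  The part of h on the
    left of the point (1 - t) (a + l) + t (b + m) serves for the leading pieces,
    which are intervals, and the part on the right for the remainders.  Masses
    are measured as a fraction theta of fixed totals F and G, so that the weights
    in the conclusion do not change during the induction. *)
Lemma averaged_prekopa_seq (L1 L2 : seq (R * R * R)) (h : RT * RT -> \bar R)
    (F G theta c : R) :
  measurable_fun setT h -> (forall p, 0 <= h p) ->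
  (forall t z, ~~ (0 <= t <= 1)%R -> h (t, z) = 0) ->
  (0 <= c)%R -> (0 < F)%R -> (0 < G)%R ->
  step_seq L1 -> step_seq L2 ->
  mass L1 = (theta * F)%R -> mass L2 = (theta * G)%R ->
  (forall p q x y, p \in L1 -> q \in L2 -> piece p x -> piece q y ->
    c%:E <= \int[mu]_t ((gmean t p.2 q.2)^-1%:E * h (t, lerp t x y))) ->
  (theta * c)%:E <= \int[mu]_t ((gmean t F G)^-1%:E * \int[mu]_z h (t, z)).
Proof.
move=> + + + c0 F0 G0.
have [k] := ubnP (size L1 + size L2)%N.
elim: k => // k IH in L1 L2 h theta *; rewrite ltnS.
move=> sz mh h0 h01 w1 w2 e1 e2 hyp.
have theta0_case : theta = 0%R ->
    (theta * c)%:E <= \int[mu]_t ((gmean t F G)^-1%:E * \int[mu]_z h (t, z)).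
  move=> ->; rewrite mul0r; apply: integral_ge0 => t _; apply: mule_ge0.
    by rewrite lee_fin invr_ge0 ltW// gmean_gt0.
  exact: integral_ge0.
case: L1 => [|p L1] in sz w1 e1 hyp *.
  apply: theta0_case; apply/eqP.
  by rewrite -(mulIr_eq0 _ (mulIf (lt0r_neq0 F0))) -e1 /mass big_nil.
case: L2 => [|q L2] in sz w2 e2 hyp *.
  apply: theta0_case; apply/eqP.
  by rewrite -(mulIr_eq0 _ (mulIf (lt0r_neq0 G0))) -e2 /mass big_nil.
have [p1 p2] : (0 < p.1.2)%R /\ (0 < p.2)%R by case/andP: w1 => /= /andP[/andP[]].
have [q1 q2] : (0 < q.1.2)%R /\ (0 < q.2)%R by case/andP: w2 => /= /andP[/andP[]].
pose tau := Num.min (p.2 * p.1.2 / F)%R (q.2 * q.1.2 / G)%R.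
pose l := (tau * F / p.2)%R; pose m := (tau * G / q.2)%R.
have tau0 : (0 < tau)%R by rewrite lt_min !divr_gt0// mulr_gt0.
have l0 : (0 < l)%R by rewrite divr_gt0// mulr_gt0.
have m0 : (0 < m)%R by rewrite divr_gt0// mulr_gt0.
have lp : (l <= p.1.2)%R.
  by rewrite /l ler_pdivrMr// -ler_pdivlMr// ge_min [(p.1.2 * _)%R]mulrC lexx.
have mq : (m <= q.1.2)%R.
  by rewrite /m ler_pdivrMr// -ler_pdivlMr// ge_min [(q.1.2 * _)%R]mulrC lexx orbT.
(* The minimum tau is attained by one of the leading pieces, which is used up. *)
have sz' : (size (cut_head p L1 l) + size (cut_head q L2 m) < k)%N.
  have : l = p.1.2 \/ m = q.1.2.
    rewrite /l /m /tau; case: leP => _; [left|right]; field; lra.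
  move: sz => /=; rewrite addSn addnS => sz.
  case=> e; [rewrite (size_cut_head_full _ e)|rewrite [X in (_ + X)%N](size_cut_head_full _ e)].
    by apply: leq_trans sz; rewrite ltnS -addnS leq_add2l size_cut_head.
  by apply: leq_trans sz; rewrite ltnS -addSn leq_add2r size_cut_head.
have l0p : (0 < l <= p.1.2)%R by rewrite l0.
have m0q : (0 < m <= q.1.2)%R by rewrite m0.
(* The cut depends on t, which is why h has to depend on t as well. *)
pose cut t := lerp t (p.1.1 + l)%R (q.1.1 + m)%R.
pose left : RT * RT -> bool := fun s => (s.2 < cut s.1)%R.
pose hL s := if left s then h s else 0.
pose hR s := if left s then 0 else h s.
have mleft : measurable_fun setT left.
  apply: measurable_fun_ltr => //; rewrite /cut /lerp.
  by apply: measurable_funD; apply: measurable_funM => //; apply: measurable_funB.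
have mhL : measurable_fun setT hL by apply: measurable_fun_ifT.
have mhR : measurable_fun setT hR by apply: measurable_fun_ifT.
have hL0 s : 0 <= hL s by rewrite /hL; case: ifP.
have hR0 s : 0 <= hR s by rewrite /hR; case: ifP.
have hL01 t z : ~~ (0 <= t <= 1)%R -> hL (t, z) = 0.
  by move=> t01; rewrite /hL h01//; case: ifP.
have hR01 t z : ~~ (0 <= t <= 1)%R -> hR (t, z) = 0.
  by move=> t01; rewrite /hR h01//; case: ifP.
have SL : (tau * c)%:E <= \int[mu]_t ((gmean t F G)^-1%:E * \int[mu]_z hL (t, z)).
  apply: (@averaged_prekopa_interval _ hL p.1.1 l p.2 q.1.1 m q.2) => //.
  - by rewrite /l; field; lra.
  - by rewrite /m; field; lra.
  move=> x y /andP[x1 x2] /andP[y1 y2].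
  apply: le_trans (hyp p q x y _ _ _ _) _; rewrite ?mem_head//.
  - by apply/andP; split => //; lra.
  - by apply/andP; split => //; lra.
  rewrite le_eqVlt; apply/predU1P; left; apply: eq_integral => t _.
  case: (boolP (0 <= t <= 1)%R) => t01; last by rewrite h01// hL01.
  by rewrite /hL /left /cut /= lerp_lt.
have SR : ((theta - tau) * c)%:E <=
    \int[mu]_t ((gmean t F G)^-1%:E * \int[mu]_z hR (t, z)).
  apply: (IH (cut_head p L1 l) (cut_head q L2 m)) => //.
  - exact: step_seq_cut_head.
  - exact: step_seq_cut_head.
  - by rewrite mass_cut_head// e1 /l; field; lra.
  - by rewrite mass_cut_head// e2 /m; field; lra.
  move=> p' q' x y p'L q'L p'x q'y.
  have [xl [p'' [p''L <- p''x]]] := piece_cut_head l0p w1 p'L p'x.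
  have [ym [q'' [q''L <- q''y]]] := piece_cut_head m0q w2 q'L q'y.
  apply: le_trans (hyp p'' q'' x y _ _ _ _) _ => //.
  rewrite le_eqVlt; apply/predU1P; left; apply: eq_integral => t _.
  case: (boolP (0 <= t <= 1)%R) => t01; last by rewrite h01// hR01.
  by rewrite /hR /left /cut /= ltNge lerp_le.
have mFh (g : RT * RT -> \bar R) : measurable_fun setT g -> (forall s, 0 <= g s) ->
    measurable_fun setT (fun t : RT => (gmean t F G)^-1%:E * \int[mu]_z g (t, z)).
  move=> mg g0; apply: emeasurable_funM; last exact: measurable_fun_fubini_tonelli_F.
  by apply/measurable_EFinP; exact: measurable_gmeanV.
have gV0 t : 0 <= (gmean t F G)^-1%:E :> \bar R.
  by rewrite lee_fin invr_ge0 ltW// gmean_gt0.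
rewrite [X in _ <= X](_ : _ =
    \int[mu]_t ((gmean t F G)^-1%:E * \int[mu]_z hL (t, z)) +
    \int[mu]_t ((gmean t F G)^-1%:E * \int[mu]_z hR (t, z))).
  rewrite (_ : (theta * c = tau * c + (theta - tau) * c)%R); last by ring.
  by rewrite EFinD; exact: leeD SL SR.
rewrite -ge0_integralD//; last 4 first.
- by move=> t _; apply: mule_ge0 => //; apply: integral_ge0.
- exact: mFh.
- by move=> t _; apply: mule_ge0 => //; apply: integral_ge0.
- exact: mFh.
apply: eq_integral => t _; rewrite -ge0_muleDr ?integral_ge0//.
rewrite -ge0_integralD//; last 2 first.
- exact: (measurableT_comp mhL (pair1_measurable t)).
- exact: (measurableT_comp mhR (pair1_measurable t)).
congr (_ * _); apply: eq_integral => z _.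
by rewrite /hL /hR; case: ifP; rewrite ?adde0 ?add0e.
Qed.

End OneDimSeq.

(** * The averaged Prekopa-Leindler inequality for grid step functions *)

Definition lerp_tuple {R : realType} n (t : R) (x y : n.-tuple R) : n.-tuple R :=
  [tuple lerp t (tnth x i) (tnth y i) | i < n].

Definition grid_cell {R : realType} n M (a eps : R) (k : n.-tuple 'I_M) :
    set (n.-tuple R) :=
  [set x | forall i, a + eps * (tnth k i)%:R <= tnth x i < a + eps * (tnth k i)%:R + eps].

Section Grid.
Context {R : realType}.
Local Notation RT := (measurableTypeR R).
Local Notation mu := (@lebesgue_measure R).
Local Open Scope ereal_scope.

Lemma ge0_integral_lebesgue_prodS n (g : n.+1.-tuple RT -> \bar R) :
  measurable_fun setT g -> (forall z, 0 <= g z) ->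
  \int[lebesgue_prod R n.+1]_z g z =
  \int[mu]_x \int[lebesgue_prod R n]_z g (cons_pair (x, z)).
Proof.
move=> mg g0.
have mc := @measurable_cons_pair R n.
rewrite -(fubini_tonelli1 (m1 := mu) (m2 := lebesgue_prod R n) (g \o @cons_pair R n))//.
- rewrite [LHS](ge0_integral_pushforward mc (lebesgue_measure \x lebesgue_prod R n))//.
- exact: measurableT_comp.
- by move=> z; exact: g0.
Qed.


Lemma averaged_prekopa_grid1 M (phi psi : 'I_M -> R) (h : RT * RT -> \bar R)
    (a eps c : R) :
  measurable_fun setT h -> (forall p, 0 <= h p) ->
  (forall t z, ~~ (0 <= t <= 1)%R -> h (t, z) = 0) ->
  (0 <= c)%R -> (0 < eps)%R ->
  (forall k, 0 <= phi k)%R -> (forall k, 0 <= psi k)%R ->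
  (0 < \sum_k phi k)%R -> (0 < \sum_k psi k)%R ->
  (forall k l x y, (0 < phi k)%R -> (0 < psi l)%R ->
    (a + eps * k%:R <= x < a + eps * k%:R + eps)%R ->
    (a + eps * l%:R <= y < a + eps * l%:R + eps)%R ->
    c%:E <= \int[mu]_t ((gmean t (phi k) (psi l))^-1%:E * h (t, lerp t x y))) ->
  c%:E <= \int[mu]_t ((gmean t (eps * \sum_k phi k) (eps * \sum_k psi k))^-1%:E *
    \int[mu]_z h (t, z)).
Proof.
move=> mh h0 h01 c0 eps0 phi0 psi0 F0 G0 hyp.
pose pieces (f : 'I_M -> R) : seq (R * R * R) :=
  [seq ((a + eps * k%:R)%R, eps, f k) | k : 'I_M <- enum 'I_M & (0 < f k)%R].
have w f : step_seq (pieces f).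
  rewrite /step_seq; apply/andP; split.
    by apply/allP => _ /mapP[k + ->]; rewrite mem_filter/= eps0 => /andP[->].
  rewrite pairwise_map; apply: (@sub_pairwise _ (fun i j : 'I_M => (i < j)%N)).
    move=> i j ij /=; have ij' : (i%:R + 1 <= j%:R :> R)%R by rewrite natr1 ler_nat.
    by rewrite -addrA lerD2l; nra.
  apply: pairwise_filter.
  rewrite -(pairwise_map val (fun i j => (i < j)%N)) val_enum_ord.
  by rewrite -sorted_pairwise ?iota_ltn_sorted//; exact: ltn_trans.
have me f : (forall k, 0 <= f k)%R -> mass (pieces f) = (1 * (eps * \sum_k f k))%R.
  move=> f0; rewrite /mass big_map big_filter big_mkcond big_enum/= mul1r mulr_sumr.
  apply: eq_bigr => k _; case: ifPn => [_|]; first by rewrite mulrC.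
  rewrite -leNgt => fk; suff -> : f k = 0%R by rewrite mulr0.
  by apply/le_anti; rewrite fk f0.
rewrite -[c]mul1r.
apply: (averaged_prekopa_seq (L1 := pieces phi) (L2 := pieces psi)) => //.
- by rewrite mulr_gt0.
- by rewrite mulr_gt0.
- exact: me.
- exact: me.
move=> _ _ x y /mapP[k kp ->] /mapP[l lp ->].
move: kp lp; rewrite !mem_filter => /andP[k0 _] /andP[l0 _] kx ly.
exact: hyp.
Qed.

Lemma lerp_tuple_cons n t (x1 y1 : R) (x y : n.-tuple R) :
  lerp_tuple t (cons_pair (x1, x)) (cons_pair (y1, y)) =
  cons_pair (lerp t x1 y1, lerp_tuple t x y).
Proof.
apply: eq_from_tnth => i; rewrite tnth_mktuple.
case: (unliftP ord0 i) => [j ->|->]; last by rewrite !tnth0.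
by rewrite !tnthS tnth_mktuple.
Qed.

Lemma lerp_tuple0 n (x y : n.-tuple R) : lerp_tuple 0 x y = x.
Proof. by apply: eq_from_tnth => i; rewrite tnth_mktuple /lerp; ring. Qed.

Lemma lerp_tuplexx n t (x : n.-tuple R) : lerp_tuple t x x = x.
Proof. by apply: eq_from_tnth => i; rewrite tnth_mktuple /lerp; ring. Qed.

Lemma big_tuple_cons (T : finType) n (f : n.+1.-tuple T -> R) :
  (\sum_k f k = \sum_i \sum_(k : n.-tuple T) f [tuple of i :: k])%R.
Proof.
rewrite pair_big/= (reindex (fun p : T * n.-tuple T => [tuple of p.1 :: p.2]))//=.
exists (fun k : n.+1.-tuple T => (thead k, [tuple of behead k])) => [[i k] _|k _].
  by congr (_, _); apply: val_inj.
by rewrite /= [RHS]tuple_eta.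
Qed.

(** Induction on the dimension.  For first coordinates x1 and y1 in given cells,
    the induction hypothesis applied to the slices of phi and psi yields exactly
    the one-dimensional hypothesis for the partial sums of phi and psi and for
    the integral of h over the remaining coordinates. *)
Lemma averaged_prekopa_grid n M (phi psi : n.-tuple 'I_M -> R)
    (h : RT * n.-tuple RT -> \bar R) (a eps c : R) :
  measurable_fun setT h -> (forall p, 0 <= h p) ->
  (forall t z, ~~ (0 <= t <= 1)%R -> h (t, z) = 0) ->
  (0 <= c)%R -> (0 < eps)%R ->
  (forall k, 0 <= phi k)%R -> (forall k, 0 <= psi k)%R ->
  (0 < \sum_k phi k)%R -> (0 < \sum_k psi k)%R ->
  (forall k l x y, (0 < phi k)%R -> (0 < psi l)%R ->
    grid_cell a eps k x -> grid_cell a eps l y ->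
    c%:E <= \int[mu]_t ((gmean t (phi k) (psi l))^-1%:E * h (t, lerp_tuple t x y))) ->
  c%:E <= \int[mu]_t ((gmean t (eps ^+ n * \sum_k phi k)
      (eps ^+ n * \sum_k psi k))^-1%:E * \int[lebesgue_prod R n]_z h (t, z)).
Proof.
elim: n => [|n IH] in phi psi h * => mh h0 h01 c0 eps0 phi0 psi0 F0 G0 hyp.
  have sum0 (f : 0.-tuple 'I_M -> R) : (\sum_k f k = f [tuple])%R.
    rewrite (bigD1 [tuple])//= big1 ?addr0// => k /eqP[]; exact: tuple0.
  rewrite !sum0 in F0 G0 *; rewrite !expr0 !mul1r.
  apply: le_trans (hyp [tuple] [tuple] [tuple] [tuple] _ _ _ _) _ => //; try by case.
  rewrite le_eqVlt; apply/predU1P; left; apply: eq_integral => t _.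
  rewrite /= integral_dirac//; last exact: (measurableT_comp mh (pair1_measurable t)).
  by rewrite diracE in_setT mul1e (tuple0 (lerp_tuple _ _ _)).
have mcons := @measurable_cons_pair R n.
pose hc (p : (RT * RT) * n.-tuple RT) := h (p.1.1, cons_pair (p.1.2, p.2)).
have mhc : measurable_fun setT hc.
  apply: (measurableT_comp mh); apply: measurable_fun_pair.
    exact: measurableT_comp.
  apply: (measurableT_comp mcons); apply: measurable_fun_pair => //.
  exact: measurableT_comp.
pose H (p : RT * RT) := \int[lebesgue_prod R n]_z hc (p, z).
have mH : measurable_fun setT H.
  by apply: (measurable_fun_fubini_tonelli_F (m2 := lebesgue_prod R n) hc) => // p; exact: h0.
pose Phi (k1 : 'I_M) := (eps ^+ n * \sum_(k : n.-tuple 'I_M) phi [tuple of k1 :: k])%R.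
pose Psi (k1 : 'I_M) := (eps ^+ n * \sum_(k : n.-tuple 'I_M) psi [tuple of k1 :: k])%R.
have epsn0 : (0 < eps ^+ n)%R by rewrite exprn_gt0.
have sumE (f : n.+1.-tuple 'I_M -> R) : (eps ^+ n.+1 * \sum_k f k =
    eps * \sum_k1 (eps ^+ n * \sum_(k : n.-tuple 'I_M) f [tuple of k1 :: k]))%R.
  by rewrite big_tuple_cons exprS -mulrA -mulr_sumr.
rewrite !sumE.
have pos (f : n.+1.-tuple 'I_M -> R) : (0 < \sum_k f k)%R ->
    (0 < \sum_k1 (eps ^+ n * \sum_(k : n.-tuple 'I_M) f [tuple of k1 :: k]))%R.
  by rewrite big_tuple_cons -mulr_sumr => f0; rewrite mulr_gt0.
rewrite [leRHS](_ : _ = \int[mu]_t ((gmean t (eps * \sum_k Phi k) (eps * \sum_k Psi k))^-1%:E *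
    \int[mu]_z H (t, z))); last first.
  apply: eq_integral => t _; congr (_ * _).
  rewrite ge0_integral_lebesgue_prodS//.
  exact: (measurableT_comp mh (pair1_measurable t)).
have Phi0 k : (0 <= Phi k)%R by rewrite mulr_ge0 ?(ltW epsn0)// sumr_ge0.
have Psi0 k : (0 <= Psi k)%R by rewrite mulr_ge0 ?(ltW epsn0)// sumr_ge0.
apply: (averaged_prekopa_grid1 (a := a)) => //.
- by move=> p; apply: integral_ge0 => z _; exact: h0.
- by move=> t z t01; apply: integral0_eq => u _; rewrite /hc h01.
- exact: pos.
- exact: pos.
move=> k1 l1 x1 y1; rewrite /Phi /Psi !pmulr_rgt0// => k10 l10 kx ly.
(* The slice of h through the first coordinate (1 - t) x1 + t y1. *)
pose h' (p : RT * n.-tuple RT) := hc ((p.1, lerp p.1 x1 y1), p.2).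
have mh' : measurable_fun setT h'.
  apply: (measurableT_comp mhc); apply: measurable_fun_pair => //.
  apply: measurable_fun_pair => //; rewrite /lerp.
  by apply: measurable_funD; apply: measurable_funM => //; apply: measurable_funB.
apply: (IH _ _ h') => //.
- by move=> p; exact: h0.
- by move=> t z t01; rewrite /h' /hc h01.
move=> k l x y k0 l0 ckx cly; rewrite /h' /hc/=.
under eq_integral do rewrite -lerp_tuple_cons.
apply: hyp => // i.
  by case: (unliftP ord0 i) => [j ->|->]; rewrite ?tnthS ?tnth0.
by case: (unliftP ord0 i) => [j ->|->]; rewrite ?tnthS ?tnth0.
Qed.

End Grid.

(** * Lower semicontinuous functions are limits of grid step functions *)

Section GridApproximation.
Context {R : realType}.
Local Notation RT := (measurableTypeR R).

Lemma measurable_grid_cell n M (a eps : R) (k : n.-tuple 'I_M) :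
  measurable (grid_cell a eps k : set (n.-tuple RT)).
Proof.
rewrite (_ : grid_cell a eps k = \bigcap_(i in [set: 'I_n])
   ((fun x : n.-tuple RT => tnth x i) @^-1`
     `[(a + eps * (tnth k i)%:R)%R, (a + eps * (tnth k i)%:R + eps)%R[%classic)).
  apply: fin_bigcap_measurable => // i _.
  by rewrite -[X in measurable X]setTI; apply: measurable_tnth.
apply/seteqP; split => x /= xk i; first by move=> _; rewrite /= in_itv/=; exact: xk.
by have := xk i Logic.I; rewrite /= in_itv.
Qed.

Lemma lebesgue_prod_grid_cell n M (a eps : R) (k : n.-tuple 'I_M) : 0 < eps ->
  lebesgue_prod R n (grid_cell a eps k) = (eps ^+ n)%:E.
Proof.
move=> eps0; elim: n => [|n IH] in k *.
  rewrite (_ : grid_cell a eps k = setT); last by apply/seteqP; split => // x _ [].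
  by rewrite /= diracE in_setT expr0.
have -> : lebesgue_prod R n.+1 (grid_cell a eps k) = (lebesgue_measure \x lebesgue_prod R n)%E
    (`[(a + eps * (thead k)%:R)%R, (a + eps * (thead k)%:R + eps)%R[%classic `*`
     grid_cell a eps [tuple of behead k]).
  rewrite /= /pushforward; congr (_ _); apply/seteqP; split => -[x1 x] /=.
    move=> xk; split.
      by have := xk ord0; rewrite tnth0 in_itv/= /thead.
    move=> i; have := xk (lift ord0 i); rewrite tnthS.
    by rewrite [k in tnth k (lift _ _)]tuple_eta tnthS.
  move=> [x1k xk] i; case: (unliftP ord0 i) => [j ->|->].
    by rewrite [k in tnth k (lift _ _)]tuple_eta !tnthS.
  by move: x1k; rewrite tnth0 in_itv/= /thead.
rewrite product_measure1E//; last exact: measurable_grid_cell.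
have muI (b : R) : lebesgue_measure `[b, b + eps[%classic = eps%:E.
  by rewrite lebesgue_measure_itv/= lte_fin ltrDl eps0 -EFinD addrAC subrr add0r.
rewrite exprS EFinM; congr (_ * _)%E; [exact: muI|exact: IH].
Qed.

Lemma grid_cell_inj n M (a eps : R) (k l : n.-tuple 'I_M) x : 0 < eps ->
  grid_cell a eps k x -> grid_cell a eps l x -> k = l.
Proof.
move=> eps0 kx lx; apply: eq_from_tnth => i; apply: val_inj => /=.
move: (kx i) (lx i) => /andP[k1 k2] /andP[l1 l2].
have lt (u v : nat) : a + eps * u%:R < a + eps * v%:R + eps -> (u < v.+1)%N.
  rewrite -addrA ltrD2l => h; rewrite -(ltr_nat R) -natr1.
  rewrite -(ltr_pM2l eps0); lra.
by apply/eqP; rewrite eqn_leq; apply/andP; split; rewrite -ltnS; apply: lt; lra.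
Qed.

(** The step of the subdivision of [-1, 1) into N + 1 intervals. *)
Definition grid_step (N : nat) : R := 2 / N.+1%:R.

Lemma grid_step_gt0 N : 0 < grid_step N.
Proof. by rewrite divr_gt0. Qed.

Lemma grid_cell_exists n N (x : n.-tuple R) :
  (forall i, -1 <= tnth x i < 1) ->
  exists k : n.-tuple 'I_N.+1, grid_cell (-1) (grid_step N) k x.
Proof.
move=> x1; pose u i : R := (tnth x i + 1) * N.+1%:R / 2.
have N0 : 0 < N.+1%:R :> R by rewrite ltr0n.
have u0 i : 0 <= u i < N.+1%:R.
  move: (x1 i) => /andP[x1i x1i']; rewrite /u; apply/andP; split.
    by rewrite divr_ge0// mulr_ge0//; lra.
  by rewrite ltr_pdivrMr// mulrC ltr_pM2l//; lra.
have lt_tr i : (Num.truncn (u i) < N.+1)%N.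
  by case/andP: (u0 i) => h1 h2; rewrite truncn_lt_nat.
exists [tuple inord (Num.truncn (u i)) | i < n] => i.
rewrite tnth_mktuple inordK//.
case/andP: (u0 i) => h1 h2.
have /andP[t1 t2] := truncn_itv h1.
have -> : tnth x i = -1 + grid_step N * u i.
  by rewrite /u /grid_step; field; rewrite lt0r_neq0.
have e0 := grid_step_gt0 N.
rewrite lerD2l -addrA ltrD2l ler_pM2l// t1/=.
by rewrite -[X in _ + X]mulr1 -mulrDr ltr_pM2l// natr1.
Qed.

(** Lower semicontinuity for the sup distance on tuples. *)
Definition lsc_tuple n (f : n.-tuple R -> R) := forall x y, y < f x ->
  exists2 e, 0 < e & forall x', (forall i, `|tnth x i - tnth x' i| < e) -> y < f x'.

Definition grid_inf n (f : n.-tuple R -> R) N (k : n.-tuple 'I_N.+1) : R :=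
  inf (f @` grid_cell (-1) (grid_step N) k).

Definition grid_approx n (f : n.-tuple R -> R) N (x : n.-tuple R) : R :=
  \sum_(k : n.-tuple 'I_N.+1) grid_inf f k * \1_(grid_cell (-1) (grid_step N) k) x.

Section Approx.
Variables (n : nat) (f : n.-tuple R -> R).
Hypothesis f0 : forall x, 0 <= f x.
Implicit Types (N : nat) (x : n.-tuple R).

Lemma grid_inf_le N (k : n.-tuple 'I_N.+1) x :
  grid_cell (-1) (grid_step N) k x -> grid_inf f k <= f x.
Proof.
move=> kx; apply: ge_inf; last by exists x.
by exists 0 => _ [y _ <-].
Qed.

Lemma grid_inf_ge N (k : n.-tuple 'I_N.+1) y :
  (forall x, grid_cell (-1) (grid_step N) k x -> y <= f x) -> y <= grid_inf f k.
Proof.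
move=> yf; apply: lb_le_inf; last by move=> _ [x kx <-]; exact: yf.
exists (f [tuple (-1 + grid_step N * (tnth k i)%:R) | i < n]).
eexists; last reflexivity.
by move=> i; rewrite tnth_mktuple lexx ltrDl grid_step_gt0.
Qed.

Lemma grid_inf_ge0 N (k : n.-tuple 'I_N.+1) : 0 <= grid_inf f k.
Proof. exact: grid_inf_ge. Qed.

Lemma grid_approxE N (k : n.-tuple 'I_N.+1) x :
  grid_cell (-1) (grid_step N) k x -> grid_approx f N x = grid_inf f k.
Proof.
move=> kx; rewrite /grid_approx (bigD1 k)//= indicE mem_set// mulr1 big1 ?addr0//.
move=> l /eqP lk; rewrite indicE memNset ?mulr0// => lx.
by apply: lk; exact: grid_cell_inj (grid_step_gt0 N) lx kx.
Qed.

Lemma grid_approx_ge0 N x : 0 <= grid_approx f N x.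
Proof. by apply: sumr_ge0 => k _; rewrite mulr_ge0// grid_inf_ge0. Qed.

Lemma grid_approx_le N x : grid_approx f N x <= f x.
Proof.
case: (pselect (exists k : n.-tuple 'I_N.+1, grid_cell (-1) (grid_step N) k x)).
  by move=> [k kx]; rewrite (grid_approxE kx) grid_inf_le.
move=> nk; rewrite /grid_approx big1// => k _.
by rewrite indicE memNset ?mulr0// => kx; apply: nk; exists k.
Qed.

Lemma measurable_grid_approx N :
  measurable_fun setT (fun x : n.-tuple RT => (grid_approx f N x)%:E).
Proof.
apply/measurable_EFinP; apply: measurable_sum => k.
apply: measurable_funM => //; apply: measurable_indic.
exact: measurable_grid_cell.
Qed.

Lemma integral_grid_approx N :
  (\int[lebesgue_prod R n]_x (grid_approx f N x)%:E =
   (grid_step N ^+ n * \sum_(k : n.-tuple 'I_N.+1) grid_inf f k)%:E)%E.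
Proof.
under eq_integral do rewrite /grid_approx -sumEFin.
rewrite ge0_integral_sum//.
- rewrite mulr_sumr -sumEFin; apply: eq_bigr => k _.
  have mk := measurable_grid_cell (-1) (grid_step N) k.
  under eq_integral do rewrite EFinM.
  rewrite ge0_integralZl//=.
  + rewrite integral_indic// setIT EFinM muleC.
    by congr (_ * _)%E; exact: lebesgue_prod_grid_cell (grid_step_gt0 N).
  + by apply/measurable_EFinP; exact: measurable_indic.
  + by rewrite lee_fin grid_inf_ge0.
- move=> k; apply/measurable_EFinP; apply: measurable_funM => //.
  by apply: measurable_indic; exact: measurable_grid_cell.
- by move=> k x _; rewrite lee_fin mulr_ge0// grid_inf_ge0.
Qed.

Hypothesis f_lsc : lsc_tuple f.
Hypothesis f_supp : forall x, f x != 0 -> forall i, -1 <= tnth x i < 1.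

(** If the cell of x is small, lower semicontinuity bounds from below the infimum
    over the cell, while the value at x bounds it from above. *)
Lemma grid_approx_cvg x : (grid_approx f N x)%:E @[N --> \oo] --> (f x)%:E.
Proof.
apply/cvg_EFin; first by near=> N.
apply/cvgrPdist_lt => e e0 /=.
have [fx0|fx0] := eqVneq (f x) 0.
  near=> N; have := grid_approx_le N x; have := grid_approx_ge0 N x.
  by rewrite fx0 => h1 h2; rewrite (_ : grid_approx f N x = 0) ?subrr ?normr0//; lra.
have [d d0 fd] := @f_lsc x (f x - e / 2) ltac:(lra).
near=> N.
have [k kx] := grid_cell_exists N (f_supp fx0).
have le1 := grid_approx_le N x.
rewrite ger0_norm ?subr_ge0// (grid_approxE kx).
have : f x - e / 2 <= grid_inf f k; last lra.
apply: grid_inf_ge => y ky; apply/ltW/fd => i.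
have stepd : grid_step N < d.
  rewrite /grid_step ltr_pdivrMr// mulrC -ltr_pdivrMr//.
  by apply: lt_le_trans (truncnS_gt _) _; rewrite ler_nat ltnS; near: N; exact: nbhs_infty_ge.
by move: (kx i) (ky i) => /andP[? ?] /andP[? ?]; rewrite ltr_norml; apply/andP; split; lra.
Unshelve. all: by end_near. Qed.

Lemma measurable_lsc : measurable_fun setT (fun x : n.-tuple RT => (f x)%:E).
Proof.
apply: (emeasurable_fun_cvg (fun N (x : n.-tuple RT) => (grid_approx f N x)%:E)) => //.
  by move=> N; exact: measurable_grid_approx.
by move=> x _; exact: grid_approx_cvg.
Qed.

Lemma grid_sum_le N :
  ((grid_step N ^+ n * \sum_(k : n.-tuple 'I_N.+1) grid_inf f k)%:E <=
   \int[lebesgue_prod R n]_x (f x)%:E)%E.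
Proof.
rewrite -integral_grid_approx; apply: ge0_le_integral => //.
- by move=> x _; rewrite lee_fin grid_approx_ge0.
- exact: measurable_grid_approx.
- exact: measurable_lsc.
- by move=> x _; rewrite lee_fin grid_approx_le.
Qed.

(** Fatou's lemma for the grid approximations, which are measurable and tend to f. *)
Lemma near_grid_sum_gt (y : \bar R) : (y < \int[lebesgue_prod R n]_x (f x)%:E)%E ->
  \forall N \near \oo,
    (y < (grid_step N ^+ n * \sum_(k : n.-tuple 'I_N.+1) grid_inf f k)%:E)%E.
Proof.
move=> yf.
have := @fatou _ _ _ (lebesgue_prod R n) setT measurableT
  (fun N (x : n.-tuple RT) => (grid_approx f N x)%:E) measurable_grid_approx
  (fun N x _ => grid_approx_ge0 N x).
under eq_integral do rewrite (cvg_limn_einf_sup (@grid_approx_cvg _)).1.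
move=> /(lt_le_trans yf); rewrite limn_einf_lim.
rewrite (cvg_lim _ (ereal_nondecreasing_cvgn _))//; last exact: nondecreasing_einfs.
move=> /ereal_sup_gt[_ [N _ <-] yN]; near=> k.
apply: (lt_le_trans yN); apply: ereal_inf_lbound; exists k => /=.
  by near: k; exists N.
by rewrite integral_grid_approx.
Unshelve. all: by end_near. Qed.

End Approx.

Lemma indic_supp n (U : set (n.-tuple R)) x :
  (forall x i, U x -> -1 <= tnth x i < 1) ->
  \1_U x != 0 :> R -> forall i, -1 <= tnth x i < 1.
Proof.
move=> Ubox; rewrite indicE; case: (boolP (x \in U)) => [|_]; last by rewrite eqxx.
by rewrite inE => Ux _ i; exact: Ubox.
Qed.

Lemma measurable_lsc_indic n (U : set (n.-tuple R)) :
  lsc_tuple (\1_U : n.-tuple R -> R) -> (forall x i, U x -> -1 <= tnth x i < 1) ->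
  measurable_fun setT (fun x : n.-tuple RT => (\1_U x : R)%:E).
Proof.
move=> lU Ubox; apply: measurable_lsc => // x.
exact: indic_supp.
Qed.

Lemma measurable_lsc_set n (U : set (n.-tuple R)) :
  lsc_tuple (\1_U : n.-tuple R -> R) -> (forall x i, U x -> -1 <= tnth x i < 1) ->
  measurable (U : set (n.-tuple RT)).
Proof.
move=> lU Ubox.
apply/(@measurable_indicP _ _ R)/measurable_EFinP; exact: measurable_lsc_indic.
Qed.

End GridApproximation.

(** * Reverse Hölder inequality from one-dimensional distribution bounds *)

Section ReverseHolder.
Context {R : realType}.
Local Notation RT := (measurableTypeR R).
Local Notation mu := (@lebesgue_measure R).

(** Superlevel sets stay open, because the function drops to 0 only outside the
    open set where phi > 1. *)
Lemma lsc_truncated_power n (phi : n.-tuple R -> R) s :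
  lsc_tuple phi -> lsc_tuple (fun x => if 1 < phi x then phi x ^+ s else 0).
Proof.
move=> lphi x y; case: ifPn => phi1; last first.
  move=> y0; exists 1 => // x' _; case: ifP => // phi1'.
  by apply: lt_le_trans y0 _; rewrite exprn_ge0// ltW// (lt_trans ltr01).
have phi0 : 0 < phi x by lra.
case: s => [|s]; rewrite ?expr0 => yphi.
  by have [e e0 he] := lphi x 1 phi1; exists e => // x' /he ->.
have y0 : 0 <= Num.max 0 y by rewrite le_max lexx.
pose z := Num.max 0 y `^ (s.+1%:R^-1).
have zs : z ^+ s.+1 = Num.max 0 y.
  by rewrite -powR_mulrn ?powR_ge0// -powRrM mulVf ?pnatr_eq0// powRr1.
have zphi : Num.max 1 z < phi x.
  rewrite gt_max phi1/= ltNge; apply/negP => phiz.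
  have : phi x ^+ s.+1 <= z ^+ s.+1 by rewrite lerXn2r// nnegrE ?powR_ge0// ltW.
  by rewrite zs le_max !leNgt yphi orbF exprn_gt0.
have [e e0 he] := lphi x _ zphi; exists e => // x' /he; rewrite gt_max => /andP[-> zx'].
apply: (@le_lt_trans _ _ (z ^+ s.+1)); first by rewrite zs le_max lexx orbT.
by rewrite ltr_pXn2r// nnegrE ?powR_ge0// (le_trans (powR_ge0 _ _) (ltW zx')).
Qed.

(** The range of parameters t over which segments are averaged: 1 - t is at most
    1 / s, so that phi^(s (1 - t)) <= phi where phi > 1, and at least 1 / (2 s), so
    that the total mass of phi^s enters the conclusion with a power bounded away
    from 0. *)
Definition window (s : nat) : set RT := `[1 - s%:R^-1, 1 - s%:R^-1 / 2]%classic.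

Lemma measurable_window s : measurable (window s).
Proof. exact: measurable_itv. Qed.

Lemma windowP s t : (0 < s)%N -> window s t ->
  [/\ 0 <= t <= 1, (1 - t) * s%:R <= 1 & 1 <= (1 - t) * (2 * s)%:R].
Proof.
move=> s0; rewrite /window/= in_itv/= => /andP[t1 t2].
have s1 : 1 <= s%:R :> R by rewrite ler1n.
have k0 : 0 < s%:R^-1 :> R by rewrite invr_gt0; lra.
have k1 : s%:R^-1 <= 1 :> R by rewrite invf_le1//; lra.
have ks : s%:R^-1 * s%:R = 1 :> R by rewrite mulVf// gt_eqF//; lra.
split; first by apply/andP; split; lra.
  by rewrite -[leRHS]ks ler_wpM2r//; lra.
have : s%:R^-1 / 2 * (2 * s%:R) <= (1 - t) * (2 * s%:R) :> R by rewrite ler_wpM2r//; lra.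
by rewrite natrM; lra.
Qed.

Lemma lebesgue_measure_window s : (0 < s)%N ->
  mu (window s) = (s%:R^-1 / 2)%:E.
Proof.
move=> s0; have k0 : 0 < s%:R^-1 :> R by rewrite invr_gt0 ltr0n.
rewrite lebesgue_measure_itv/= lte_fin ifT; last by lra.
by rewrite -EFinB; congr EFin; lra.
Qed.

Lemma gmean_window_le s t (w b x : R) : (0 < s)%N -> window s t ->
  1 < x -> 0 < w <= x ^+ s -> 0 < b <= 1 -> gmean t w b <= x.
Proof.
move=> s0 /(windowP s0)[t01 ts _] x1 /andP[w0 wx] /andP[b0 b1].
have x0 : 0 < x by lra.
have lnx : 0 <= ln x by rewrite ln_ge0// ltW.
apply: le_trans (le_gmean t01 w0 b0 wx b1) _.
rewrite -[leRHS]lnK ?posrE// /gmean ler_expR ln1 mulr0 addr0 lnXn// -mulr_natl mulrA.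
by rewrite ler_piMl.
Qed.

Lemma gmean_window_ge s t (F G M : R) : (0 < s)%N -> window s t ->
  1 <= M -> 0 < G -> M ^+ (2 * s) * G <= F -> G * M <= gmean t F G.
Proof.
move=> s0 /(windowP s0)[/andP[t0 t1] _ ts] M1 G0 FG.
have M0 : 0 < M by lra.
have MG0 : 0 < M ^+ (2 * s) * G by rewrite mulr_gt0// exprn_gt0.
have lnF : (2 * s)%:R * ln M + ln G <= ln F.
  rewrite mulr_natl -lnXn// -lnM ?posrE// ?exprn_gt0// ler_ln ?posrE//.
  exact: lt_le_trans FG.
have lnM0 : 0 <= ln M by rewrite ln_ge0.
rewrite -[leLHS]lnK ?posrE ?mulr_gt0// /gmean ler_expR lnM ?posrE//.
have := ler_wpM2l (_ : 0 <= 1 - t) lnF; rewrite subr_ge0 => /(_ t1).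
have : ln M <= (1 - t) * (2 * s)%:R * ln M by rewrite ler_peMl.
lra.
Qed.

Lemma measurable_lerp_tuple n (x y : n.-tuple R) :
  measurable_fun setT (fun t : RT => lerp_tuple t x y : n.-tuple RT).
Proof.
apply/measurable_fun_tnthP => i.
rewrite (_ : _ \o _ = (fun t => lerp t (tnth x i) (tnth y i))).
  rewrite /lerp; apply: measurable_funD; apply: measurable_funM => //.
  exact: measurable_funB.
by apply/funext => t /=; rewrite tnth_mktuple.
Qed.

Local Open Scope ereal_scope.

Lemma measurable_segment_sublevel n (phi : n.-tuple R -> R) (x y : n.-tuple R) (b : R) :
  measurable_fun setT (fun x : n.-tuple RT => (phi x)%:E) ->
  measurable ([set t : R | (0 <= t <= 1)%R /\ (phi (lerp_tuple t x y) < b)%R] : set RT).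
Proof.
move=> mphi.
have mphit : measurable_fun setT (fun t : RT => (phi (lerp_tuple t x y))%:E).
  exact: (measurableT_comp mphi (@measurable_lerp_tuple n x y)).
rewrite (_ : [set t | _] = `[0%R, 1%R]%classic `&`
   (fun t => (phi (lerp_tuple t x y))%:E) @^-1` `]-oo, b%:E[%classic).
  apply: measurableI; first exact: measurable_itv.
  by rewrite -[X in measurable X]setTI; apply: mphit => //; exact: emeasurable_itv.
by apply/seteqP; split => t; rewrite /= !in_itv/= lte_fin.
Qed.

(** The window has length 1 / (2 s) and the exceptional set at most half of it.  On
    the rest, phi along the segment is at least phi x / L while the weight is at
    least 1 / phi x. *)
Lemma window_integral_ge n (phi : n.-tuple R -> R) (s : nat) (L w b : R) (x y : n.-tuple R) :
  (0 < s)%N -> (0 < L)%R -> (forall x, 0 <= phi x)%R ->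
  measurable_fun setT (fun x : n.-tuple RT => (phi x)%:E) ->
  mu [set t | (0 <= t <= 1)%R /\ (phi (lerp_tuple t x y) < phi x / L)%R] <=
    ((4 * s%:R)^-1)%:E ->
  (1 < phi x)%R -> (0 < w <= phi x ^+ s)%R -> (0 < b <= 1)%R ->
  ((4 * s%:R)^-1 / L)%:E <=
  \int[mu]_t ((gmean t w b)^-1%:E *
     ((\1_(window s) t : R)%:E * (phi (lerp_tuple t x y))%:E)).
Proof.
move=> s0 L0 phi0 mphi + phi1 hw hb.
have mphit : measurable_fun setT (fun t : RT => (phi (lerp_tuple t x y))%:E).
  exact: (measurableT_comp mphi (@measurable_lerp_tuple n x y)).
set bad := (X in mu X) => bad_le.
have mbad : measurable (bad : set RT) by exact: measurable_segment_sublevel.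
have mW := measurable_window s.
have good_ge : ((4 * s%:R)^-1)%:E <= mu (window s `\` bad).
  have : mu (window s) <= mu (window s `\` bad) + mu bad.
    apply: (@le_trans _ _ (mu ((window s `\` bad) `|` bad))).
      apply: le_measure; rewrite ?inE//.
        by apply: measurableU => //; exact: measurableD.
      by move=> t Wt; case: (pselect (bad t)) => ?; [right|left].
    by apply: measureU2 => //; exact: measurableD.
  rewrite lebesgue_measure_window// => /le_trans /(_ (leeD2l _ bad_le)).
  rewrite -leeBlDr// -EFinB; apply: le_trans; rewrite lee_fin.
  by rewrite invfM; lra.
rewrite EFinM muleC.
apply: (@le_trans _ _ (\int[mu]_(t in window s `\` bad) (L^-1)%:E)).
  rewrite integral_cst//; last exact: measurableD.
  by apply: lee_wpmul2l => //; rewrite lee_fin invr_ge0 ltW.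
rewrite integral_mkcond; apply: ge0_le_integral => //.
- by move=> t _; rewrite patchE; case: ifP => // _; rewrite lee_fin invr_ge0 ltW.
- by apply/(measurable_restrictT _ _).1 => //; exact: measurableD.
- apply: emeasurable_funM; first by apply/measurable_EFinP; exact: measurable_gmeanV.
  apply: emeasurable_funM => //; apply/measurable_EFinP.
  exact: measurable_indic.
move=> t _; rewrite patchE; case: ifPn => [|_]; last first.
  by rewrite -!EFinM lee_fin !mulr_ge0// invr_ge0 ltW// gmean_gt0.
rewrite inE => -[Wt nbad].
have [t01 _ _] := windowP s0 Wt.
have le_phi : (phi x / L <= phi (lerp_tuple t x y))%R.
  by rewrite leNgt; apply/negP => lt_phi; apply: nbad.
rewrite indicE mem_set// mul1e -EFinM lee_fin.
have gx := gmean_window_le s0 Wt phi1 hw hb.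
rewrite ler_pdivlMl ?gmean_gt0//; apply: le_trans le_phi.
by rewrite ler_wpM2r// invr_ge0 ltW.
Qed.

(** The averaged Prekopa-Leindler inequality for h = phi and the grid
    approximations of f = phi^s 1_{phi > 1} and of 1_U.  Let F and G be the
    integrals of the latter two.  If the integral of f were larger than
    (4L)^(2s) v, so would be F on a fine grid, and the weights F^-(1-t) G^-t would
    be at most 1 / (4 L G) in the window, with G > v / 2; the conclusion would
    contradict the lower bound 1 / (4 s L). *)
Lemma truncated_moment_le n (U : set (n.-tuple R)) (phi : n.-tuple R -> R)
    (s : nat) (L v : R) :
  (0 < s)%N -> (1 <= L)%R -> (0 < v)%R ->
  (forall x, 0 <= phi x)%R -> (forall x, phi x != 0 -> U x)%R ->
  lsc_tuple phi -> lsc_tuple (\1_U : n.-tuple R -> R) ->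
  (forall x i, U x -> -1 <= tnth x i < 1)%R ->
  (forall x y, U x -> U y -> (0 < phi x)%R ->
    mu [set t | (0 <= t <= 1)%R /\ (phi (lerp_tuple t x y) < phi x / L)%R] <=
      ((4 * s%:R)^-1)%:E) ->
  lebesgue_prod R n U = v%:E ->
  \int[lebesgue_prod R n]_x (phi x)%:E <= v%:E ->
  \int[lebesgue_prod R n]_x (if (1 < phi x)%R then phi x ^+ s else 0)%:E <=
    ((4 * L) ^+ (2 * s) * v)%:E.
Proof.
move=> s0 L1 v0 phi0 phiU lphi lU Ubox dil Uv phiv.
set f := fun x => if (1 < phi x)%R then (phi x ^+ s)%R else 0%R.
pose C := ((4 * L) ^+ (2 * s))%R.
rewrite leNgt; apply/negP => Cf.
have f0 x : (0 <= f x)%R by rewrite /f; case: ifP => // _; rewrite exprn_ge0.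
have lf : lsc_tuple f := @lsc_truncated_power n phi s lphi.
have fU x : (0 < f x)%R -> (1 < phi x)%R /\ f x = (phi x ^+ s)%R.
  by rewrite /f; case: ifP => //; rewrite ltxx.
have fbox x : f x != 0%R -> forall i, (-1 <= tnth x i < 1)%R.
  move=> fx i; apply: Ubox; apply: phiU; move: fx; rewrite /f; case: ifP => [h _|_].
    by rewrite gt_eqF// (lt_trans ltr01).
  by rewrite eqxx.
have i0 x : (0 <= \1_U x :> R)%R by [].
have ibox := fun x => @indic_supp R n U x Ubox.
have mphi : measurable_fun setT (fun x : n.-tuple RT => (phi x)%:E).
  by apply: measurable_lsc => // x /phiU Ux i; exact: Ubox.
have mU : measurable (U : set (n.-tuple RT)).
  exact: measurable_lsc_set.
have iv : \int[lebesgue_prod R n]_x (\1_U x : R)%:E = v%:E.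
  by rewrite integral_indic// setIT.
(* One grid for both approximations, fine enough for F > C v and G > v / 2. *)
near \oo%classic => N.
pose eps : R := grid_step N; pose F := (eps ^+ n * \sum_(k : n.-tuple 'I_N.+1) grid_inf f k)%R.
pose G := (eps ^+ n * \sum_(k : n.-tuple 'I_N.+1) grid_inf (\1_U : _ -> R) k)%R.
have FC : (C * v < F)%R.
  by rewrite /F /eps -lte_fin; near: N; exact: near_grid_sum_gt.
have Gv : (v / 2 < G)%R.
  rewrite /G /eps -lte_fin; near: N; apply: near_grid_sum_gt => //.
  by rewrite iv lte_fin; lra.
have Gv' : (G <= v)%R by rewrite -lee_fin -iv; exact: grid_sum_le.
have G0 : (0 < G)%R by lra.
have L40 : (1 <= 4 * L)%R by lra.
have C1 : (1 <= C)%R by rewrite exprn_ege1.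
have F0 : (0 < F)%R by apply: lt_trans FC; rewrite mulr_gt0//; lra.
have Ws := windowP s0.
have mW := measurable_window s.
pose h (p : RT * n.-tuple RT) := ((\1_(window s) p.1 : R)%:E * (phi p.2)%:E)%E.
have mh : measurable_fun setT h.
  apply: emeasurable_funM => //.
    by apply/measurable_EFinP; apply: (@measurableT_comp _ _ _ _ _ _ (\1_(window s) : RT -> R)).
  exact: (measurableT_comp mphi (@measurable_snd _ _ RT (n.-tuple RT))).
have h0 p : 0 <= h p by rewrite mule_ge0// lee_fin.
have h01 t z : ~~ (0 <= t <= 1)%R -> h (t, z) = 0.
  by move=> t01; rewrite /h/= indicE memNset ?mul0e// => /Ws[tin]; rewrite tin in t01.
pose c := ((4 * s%:R)^-1 / L)%R.
have c0 : (0 <= c)%R by rewrite divr_ge0 ?invr_ge0 ?mulr_ge0// (le_trans ler01).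
have := @averaged_prekopa_grid R n N.+1 (@grid_inf _ _ f N)
  (@grid_inf _ _ (\1_U : _ -> R) N) h (-1) eps c mh h0 h01 c0 (grid_step_gt0 N)
  (@grid_inf_ge0 _ _ _ f0 N) (@grid_inf_ge0 _ _ _ i0 N).
have epsn : (0 < eps ^+ n)%R by rewrite exprn_gt0// grid_step_gt0.
rewrite -(pmulr_rgt0 _ epsn) -(pmulr_rgt0 (\sum_k grid_inf (\1_U : _ -> R) k)%R epsn).
rewrite -/F -/G => /(_ F0 G0) concl.
have {concl} : c%:E <= \int[mu]_t ((gmean t F G)^-1%:E *
    \int[lebesgue_prod R n]_z h (t, z)).
  apply: concl => k l x y fk il kx ly.
  have fx' := grid_inf_le f0 kx.
  have /fU[phi1 fx] : (0 < f x)%R := lt_le_trans fk fx'.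
  have Ux : U x by apply: phiU; rewrite gt_eqF// (lt_trans ltr01).
  have il' := grid_inf_le i0 ly.
  have Uy : U y.
    apply: contrapT => nUy; move: (lt_le_trans il il').
    by rewrite indicE memNset// ltxx.
  apply: window_integral_ge => //.
  - exact: lt_le_trans ltr01 L1.
  - by apply: dil => //; exact: lt_trans ltr01 phi1.
  - by rewrite fk -fx.
  - by rewrite il (le_trans il')// indicE mem_set.
apply/negP; rewrite -ltNge.
have gmF t : window s t -> (G * (4 * L) <= gmean t F G)%R.
  move=> Wt; apply: (gmean_window_ge s0 Wt) => //.
  by apply: le_trans (ltW FC); rewrite ler_wpM2l// exprn_ge0// (le_trans ler01).
have GL0 : (0 < G * (4 * L))%R by rewrite mulr_gt0// (lt_le_trans ltr01).
have bound : \int[mu]_t ((gmean t F G)^-1%:E * \int[lebesgue_prod R n]_z h (t, z)) <=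
    \int[mu]_(t in window s) (v / (G * (4 * L)))%:E.
  rewrite [leRHS]integral_mkcond; apply: ge0_le_integral => //.
  - by move=> t _; rewrite mule_ge0 ?integral_ge0// lee_fin invr_ge0 ltW// gmean_gt0.
  - apply: emeasurable_funM; last exact: measurable_fun_fubini_tonelli_F.
    by apply/measurable_EFinP; exact: measurable_gmeanV.
  - by apply/(measurable_restrictT _ _).1.
  move=> t _; rewrite patchE; case: ifPn => tD; last first.
    rewrite integral0_eq ?mule0// => z _.
    by rewrite /h/= indicE (negbTE tD) mul0e.
  rewrite [(v / _)%R]mulrC EFinM; apply: lee_pmul.
  - by rewrite lee_fin invr_ge0 ltW// gmean_gt0.
  - exact: integral_ge0.
  - by rewrite lee_fin lef_pV2 ?posrE ?gmean_gt0// gmF// -inE.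
  - rewrite /h; under eq_integral do rewrite /= indicE tD mul1e.
    exact: phiv.
apply: (le_lt_trans bound).
rewrite integral_cst// [X in _ * X](lebesgue_measure_window s0) -EFinM lte_fin /c.
rewrite [ltRHS](_ : _ = (2 * G) / (G * (4 * L)) * (s%:R^-1 / 2))%R; last first.
  by field; rewrite !gt_eqF//= ?(lt_le_trans _ L1)// ltr0n.
rewrite ltr_pM2r; last by rewrite divr_gt0// invr_gt0 ltr0n.
by rewrite ltr_pM2r ?invr_gt0//; lra.
Unshelve. all: by end_near. Qed.

End ReverseHolder.

Section UnnormalizedReverseHolder.
Context {R : realType}.
Local Notation RT := (measurableTypeR R).
Local Notation mu := (@lebesgue_measure R).
Local Open Scope ereal_scope.

Lemma lsc_scale n (phi : n.-tuple R -> R) (k : R) : (0 < k)%R ->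
  lsc_tuple phi -> lsc_tuple (fun x => k * phi x)%R.
Proof.
move=> k0 lphi x y; rewrite -ltr_pdivrMl// => /lphi[e e0 he].
by exists e => // x' /he; rewrite ltr_pdivrMl.
Qed.

(** Homogeneous form: phi v / A has mean at most 1, and the part where it is at most
    1 contributes at most v to the s-th moment. *)
Lemma moment_le_of_mean n (U : set (n.-tuple R)) (phi : n.-tuple R -> R)
    (s : nat) (L v A : R) :
  (0 < s)%N -> (1 <= L)%R -> (0 < v)%R -> (0 < A)%R ->
  (forall x, 0 <= phi x)%R -> (forall x, phi x != 0 -> U x)%R ->
  lsc_tuple phi -> lsc_tuple (\1_U : n.-tuple R -> R) ->
  (forall x i, U x -> -1 <= tnth x i < 1)%R ->
  (forall x y, U x -> U y -> (0 < phi x)%R ->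
    mu [set t | (0 <= t <= 1)%R /\ (phi (lerp_tuple t x y) < phi x / L)%R] <=
      ((4 * s%:R)^-1)%:E) ->
  lebesgue_prod R n U = v%:E ->
  \int[lebesgue_prod R n]_x (phi x)%:E <= A%:E ->
  \int[lebesgue_prod R n]_x (phi x ^+ s)%:E <=
    ((1 + (4 * L) ^+ (2 * s)) * (A / v) ^+ s * v)%:E.
Proof.
move=> s0 L1 v0 A0 phi0 phiU lphi lU Ubox dil Uv phiA.
have k0 : (0 < v / A)%R by rewrite divr_gt0.
pose psi x := (v / A * phi x)%R.
have psi0 x : (0 <= psi x)%R by rewrite mulr_ge0// ltW.
have mphi : measurable_fun setT (fun x : n.-tuple RT => (phi x)%:E).
  by apply: measurable_lsc => // x /phiU Ux i; exact: Ubox.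
have lpsi : lsc_tuple psi by exact: lsc_scale.
have trunc_le := @truncated_moment_le R n U psi s L v s0 L1 v0 psi0.
have {trunc_le} := trunc_le _ lpsi lU Ubox _ Uv _.
set f := fun x => if (1 < psi x)%R then (psi x ^+ s)%R else 0%R.
have f0 x : (0 <= f x)%R by rewrite /f; case: ifP => // _; rewrite exprn_ge0.
have phi_ne0 x : psi x != 0%R -> phi x != 0%R.
  by apply: contra_neq => e; rewrite /psi e mulr0.
have mU1 := measurable_lsc_indic lU Ubox.
have mU := measurable_lsc_set lU Ubox.
have mf : measurable_fun setT (fun x : n.-tuple RT => (f x)%:E).
  apply: measurable_lsc => //; first exact: lsc_truncated_power.
  move=> x fx i; apply/Ubox/phiU/phi_ne0; move: fx; rewrite /f; case: ifP => [h _|_].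
    by rewrite gt_eqF// (lt_trans ltr01).
  by rewrite eqxx.
move=> trunc_le.
have fint : \int[lebesgue_prod R n]_x (f x)%:E <= ((4 * L) ^+ (2 * s) * v)%:E.
  apply: trunc_le.
  - by move=> x /phi_ne0; exact: phiU.
  - move=> x y Ux Uy; rewrite /psi pmulr_rgt0// => phix0.
    have e z : (v / A * phi z < v / A * phi x / L)%R = (phi z < phi x / L)%R.
      by rewrite -(mulrA (v / A)%R) ltr_pM2l.
    by under [X in mu X]eq_set do rewrite e; exact: dil.
  - under eq_integral do rewrite EFinM.
    rewrite ge0_integralZl//=.
    + apply: (le_trans (lee_wpmul2l _ phiA)); first by rewrite lee_fin ltW.
      by rewrite -EFinM lee_fin divfK// gt_eqF.
    + by move=> x _; rewrite lee_fin.
    + by rewrite lee_fin ltW.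
have sumE : \int[lebesgue_prod R n]_x ((\1_U x : R)%:E + (f x)%:E) <=
    ((1 + (4 * L) ^+ (2 * s)) * v)%:E.
  rewrite ge0_integralD//; last by move=> x _; rewrite lee_fin.
  rewrite integral_indic// setIT [X in X + _]Uv mulrDl mul1r EFinD.
  exact: leeD2l.
have Av0 : (0 <= (A / v) ^+ s)%R by rewrite exprn_ge0// divr_ge0// ltW.
rewrite mulrAC mulrC EFinM.
apply: le_trans (lee_wpmul2l _ sumE); last by rewrite lee_fin.
have pos x : 0 <= (\1_U x : R)%:E + (f x)%:E by rewrite adde_ge0 ?lee_fin.
rewrite -ge0_integralZl//=; last exact: emeasurable_funD.
apply: ge0_le_integral => //.
- by move=> x _; rewrite lee_fin exprn_ge0.
- apply/measurable_EFinP; apply: measurable_funX.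
  exact/measurable_EFinP.
- by apply: emeasurable_funM => //; apply: emeasurable_funD.
move=> x _; rewrite -EFinD -EFinM lee_fin.
have -> : (phi x = A / v * psi x)%R by rewrite /psi; field; rewrite !gt_eqF.
rewrite exprMn ler_wpM2l// /f.
case: ifPn => psi1; first by rewrite lerDr.
rewrite addr0 indicE; case: (boolP (x \in U)) => xU.
  by rewrite expr_le1// leNgt.
suff -> : psi x = 0%R by rewrite expr0n gtn_eqF.
apply/eqP; apply: contraNT xU => /phi_ne0/phiU; exact: mem_set.
Qed.

End UnnormalizedReverseHolder.

(** * Dilations, and the boundary of a convex set *)

Section Boundary.
Context {R : realType}.
Local Notation RT := (measurableTypeR R).
Local Notation mu := (@lebesgue_measure R).
Local Open Scope ereal_scope.

Definition affine_tuple n (a : R) (b x : n.-tuple R) : n.-tuple R :=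
  [tuple (a * tnth x i + tnth b i)%R | i < n].

Lemma measurable_affine_tuple n a (b : n.-tuple R) :
  measurable_fun setT (affine_tuple a b : n.-tuple RT -> n.-tuple RT).
Proof.
apply/measurable_fun_tnthP => i.
rewrite (_ : _ \o _ = (fun x => a * x + tnth b i)%R \o (fun x : n.-tuple RT => tnth x i)).
  exact: (measurableT_comp (measurable_affine a (tnth b i)) (@measurable_tnth _ RT n i)).
by apply/funext => x /=; rewrite tnth_mktuple.
Qed.

Lemma affine_tuple_cons n a (b1 x1 : R) (b x : n.-tuple R) :
  affine_tuple a (cons_pair (b1, b)) (cons_pair (x1, x)) =
  cons_pair ((a * x1 + b1)%R, affine_tuple a b x).
Proof.
apply: eq_from_tnth => i; rewrite tnth_mktuple.
case: (unliftP ord0 i) => [j ->|->]; last by rewrite !tnth0.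
by rewrite !tnthS tnth_mktuple.
Qed.

Lemma ge0_integral_affine_tuple n a (b : n.-tuple R) (g : n.-tuple RT -> \bar R) :
  (0 < a)%R -> measurable_fun setT g -> (forall x, 0 <= g x) ->
  \int[lebesgue_prod R n]_x g x =
  (a ^+ n)%:E * \int[lebesgue_prod R n]_x g (affine_tuple a b x).
Proof.
move=> a0; elim: n => [|n IH] in b g * => mg g0.
  rewrite expr0 mul1e; apply: eq_integral => x _; congr g.
  by rewrite (tuple0 x) [RHS]tuple0.
rewrite (tuple_eta b) -[[tuple of _]]/(cons_pair (thead b, [tuple of behead b])).
set b1 := thead b; set b' := [tuple of behead b].
have mc := @measurable_cons_pair R n.
rewrite !ge0_integral_lebesgue_prodS//; last first.
  exact: (measurableT_comp mg (measurable_affine_tuple _ _)).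
pose gc (p : RT * n.-tuple RT) := g (cons_pair p).
have mgc : measurable_fun setT gc by exact: measurableT_comp mg mc.
pose G (p : RT) := \int[lebesgue_prod R n]_z gc (p, affine_tuple a b' z).
have mgc' : measurable_fun setT (fun p : RT * n.-tuple RT => gc (p.1, affine_tuple a b' p.2)).
  apply: (measurableT_comp mgc); apply: measurable_fun_pair => //.
  exact: (measurableT_comp (measurable_affine_tuple a b') (@measurable_snd _ _ RT (n.-tuple RT))).
have mG : measurable_fun setT G.
  by apply: (measurable_fun_fubini_tonelli_F (m2 := lebesgue_prod R n)
    (fun p : RT * n.-tuple RT => gc (p.1, affine_tuple a b' p.2))) => // p; exact: g0.
have G0 x : 0 <= G x by apply: integral_ge0 => z _; exact: g0.
transitivity (\int[mu]_x ((a ^+ n)%:E * G x)).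
  apply: eq_integral => x _; apply: (IH b' (fun z => gc (x, z))).
    exact: (measurableT_comp mgc (pair1_measurable x)).
  by move=> z; exact: g0.
have an0 : (0 <= a ^+ n)%R by rewrite exprn_ge0// ltW.
rewrite (ge0_integralZl _ measurableT mG (fun x _ => G0 x)); last by rewrite lee_fin.
rewrite [X in _ * X](ge0_integral_affine b1 a0 mG G0).
rewrite muleA -EFinM -exprSr.
congr (_ * _); apply: eq_integral => x _; apply: eq_integral => z _.
by rewrite affine_tuple_cons.
Qed.

Lemma lebesgue_prod_preimage_affine n a (b : n.-tuple R) (U : set (n.-tuple RT)) :
  (0 < a)%R -> measurable U ->
  lebesgue_prod R n U = (a ^+ n)%:E * lebesgue_prod R n (affine_tuple a b @^-1` U).
Proof.
move=> a0 mU; have maU : measurable (affine_tuple a b @^-1` U : set (n.-tuple RT)).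
  by rewrite -[X in measurable X]setTI; exact: measurable_affine_tuple.
have mi : measurable_fun setT (fun x : n.-tuple RT => (\1_U x : R)%:E).
  by apply/measurable_EFinP; exact: measurable_indic.
have := ge0_integral_affine_tuple b a0 mi (fun x => ltac:(by rewrite lee_fin)).
rewrite integral_indic// setIT => ->; congr (_ * _).
have := integral_indic (lebesgue_prod R n) measurableT maU.
by rewrite setIT => <-; apply: eq_integral => x _; rewrite !indicE.
Qed.

Lemma lebesgue_tuple_measurable n (U : set (n.-tuple RT)) : measurable U ->
  lebesgue_tuple R n U = lebesgue_prod R n U.
Proof. exact: measurable_mu_extE. Qed.

Lemma bernoulli_ineq n (e : R) : (0 <= e <= 1 -> 1 - n%:R * e <= (1 - e) ^+ n)%R.
Proof.
move=> /andP[e0 e1]; elim: n => [|n IH]; first by rewrite mul0r subr0.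
rewrite exprS; have n0 : (0 <= n%:R :> R)%R by [].
have : ((1 - e) * (1 - n%:R * e) <= (1 - e) * (1 - e) ^+ n)%R by rewrite ler_wpM2l// subr_ge0.
rewrite -natr1; nra.
Qed.

(** W lies in the dilation of U by 1 / (1 - e) about x0, whose volume is
    v / (1 - e)^n; let e tend to 0.  The set W need not be Borel, so the bound is
    one for the outer measure. *)
Lemma lebesgue_tuple_convex_boundary n (U W : set (n.-tuple R)) (x0 : n.-tuple R) (v : R) :
  measurable (U : set (n.-tuple RT)) -> lebesgue_prod R n U = v%:E ->
  U `<=` W -> (forall x e, W x -> 0 < e < 1 -> U (lerp_tuple e x x0))%R ->
  lebesgue_tuple R n (W `\` U) = 0.
Proof.
move=> mU Uv UW Wx.
have shrink e : (0 < e < 1)%R ->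
    lebesgue_tuple R n (W `\` U) <= (v / (1 - e) ^+ n - v)%:E.
  move=> e01; case/andP: (e01) => e0 e1.
  have e1' : (0 < 1 - e)%R by lra.
  pose b : n.-tuple R := [tuple (e * tnth x0 i)%R | i < n].
  pose E := affine_tuple (1 - e) b @^-1` U.
  have mE : measurable (E : set (n.-tuple RT)).
    by rewrite -[X in measurable X]setTI; exact: measurable_affine_tuple.
  have WE : W `<=` E.
    move=> x Wx0; rewrite /E/=.
    suff -> : affine_tuple (1 - e) b x = lerp_tuple e x x0 by exact: Wx.
    by apply: eq_from_tnth => i; rewrite !tnth_mktuple.
  have Ev : lebesgue_prod R n E = (v / (1 - e) ^+ n)%:E.
    have := lebesgue_prod_preimage_affine b e1' mU.
    rewrite Uv -/E => h.
    have -> : (v / (1 - e) ^+ n = ((1 - e) ^+ n)^-1 * v)%R by rewrite mulrC.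
    by rewrite EFinM h muleA -EFinM mulVf ?mul1e// gt_eqF// exprn_gt0.
  apply: (@le_trans _ _ (lebesgue_tuple R n (E `\` U))).
    have sub : W `\` U `<=` E `\` U by apply: setSD.
    exact: (le_mu_ext (lebesgue_prod R n) sub).
  rewrite lebesgue_tuple_measurable; last exact: measurableD.
  have Eoo : lebesgue_prod R n E < +oo by rewrite Ev ltry.
  rewrite measureD// (setIidr (subset_trans UW WE)).
  by rewrite [X in X - _]Ev [X in _ - X]Uv.
have v0 : (0 <= v)%R by rewrite -lee_fin -Uv.
have N0 : 0 <= lebesgue_tuple R n (W `\` U) by exact: mu_ext_ge0.
have mfin : lebesgue_tuple R n (W `\` U) \is a fin_num.
  rewrite ge0_fin_numE//; apply: le_lt_trans (shrink (2^-1)%R _) (ltry _).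
  by apply/andP; split; lra.
pose a := fine (lebesgue_tuple R n (W `\` U)).
have aE : lebesgue_tuple R n (W `\` U) = a%:E by rewrite fineK.
have a_ge0 : (0 <= a)%R by rewrite fine_ge0.
rewrite aE; congr EFin; apply/le_anti; rewrite a_ge0 andbT leNgt; apply/negP => a0.
clear mfin.
have n1 : (0 < n.+1%:R :> R)%R by rewrite ltr0n.
(* With this e, Bernoulli's inequality turns the bound into a <= a / 2. *)
pose e := (a / (2 * n.+1%:R * (a + v)))%R.
have av0 : (0 < a + v)%R by lra.
have e0 : (0 < e)%R by rewrite divr_gt0// !mulr_gt0.
have ne : (n.+1%:R * e * (a + v) = a / 2)%R.
  by rewrite /e; field; rewrite !gt_eqF.
have n1' : (1 <= n.+1%:R :> R)%R by rewrite ler1n.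
have e1 : (e < 1)%R.
  rewrite ltr_pdivrMr ?mul1r ?mulr_gt0//.
  have : (a + v <= n.+1%:R * (a + v))%R by rewrite ler_peMl// ltW.
  lra.
have := shrink e ltac:(by rewrite e0).
rewrite aE lee_fin lerBrDr ler_pdivlMr ?exprn_gt0 ?subr_gt0//.
apply/negP; rewrite -ltNge.
have := @bernoulli_ineq n e ltac:(by rewrite !ltW).
move=> /(ler_wpM2l (ltW av0)); apply: lt_le_trans.
have : (n%:R * e * (a + v) <= n.+1%:R * e * (a + v))%R.
  by rewrite !ler_wpM2r ?ler_nat// ltW.
rewrite ne; nra.
Qed.

End Boundary.

(** * Integrals for the completed measure *)

Section Completion.
Context {R : realType}.
Local Notation RT := (measurableTypeR R).
Local Open Scope ereal_scope.
Variables (n : nat).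
Local Notation cT := (caratheodory_type (lebesgue_prod R n)^*%mu).

Lemma caratheodory_borel (U : set (n.-tuple RT)) : measurable U -> measurable (U : set cT).
Proof. by move=> mU; apply: sub_caratheodory; exact: sub_sigma_algebra. Qed.

Lemma caratheodory_null (N : set (n.-tuple RT)) :
  lebesgue_tuple R n N = 0 -> measurable (N : set cT).
Proof.
move=> N0; apply: le_caratheodory_measurable => X.
have XN : lebesgue_tuple R n (X `&` N) = 0.
  apply/eqP; rewrite eq_le mu_ext_ge0// andbT -N0.
  by apply: (le_mu_ext (lebesgue_prod R n)); exact: subIsetr.
rewrite [X in X + _]XN add0e.
by apply: (le_mu_ext (lebesgue_prod R n)); exact: subIsetl.
Qed.

Lemma measurable_id_caratheodory : measurable_fun [set: cT] (id : cT -> n.-tuple RT).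
Proof. by move=> _ Y mY; rewrite setTI; exact: caratheodory_borel. Qed.

Variables (U W : set (n.-tuple RT)).
Hypotheses (mU : measurable U) (UW : U `<=` W) (WU0 : lebesgue_tuple R n (W `\` U) = 0).

Lemma lebesgue_tuple_null_extension : lebesgue_tuple R n W = lebesgue_prod R n U.
Proof.
rewrite -lebesgue_tuple_measurable//.
apply/eqP; rewrite eq_le; apply/andP; split; last exact: (le_mu_ext (lebesgue_prod R n)).
rewrite -[leRHS]adde0 -WU0 -[in leLHS](setDUK UW).
apply: measureU2; first exact: caratheodory_borel.
exact: caratheodory_null.
Qed.

(** W differs from the Borel set U by a null set, on which g may be arbitrary: by
    completeness g is still measurable on W.  On Borel functions the completed
    measure and the product measure agree, the former being carried to the
    latter by the identity map. *)
Lemma ge0_integral_lebesgue_tuple (g k : n.-tuple RT -> \bar R) :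
  measurable_fun setT k -> (forall x, 0 <= g x) -> (forall x, 0 <= k x) ->
  (forall x, U x -> k x = g x) -> (forall x, ~ U x -> k x = 0) ->
  \int[lebesgue_tuple R n]_(x in W) g x = \int[lebesgue_prod R n]_x k x.
Proof.
move=> mk g0 k0 kg kU.
have mid := measurable_id_caratheodory.
have mN := caratheodory_null WU0.
have mU' := caratheodory_borel mU.
have mkc : measurable_fun [set: cT] k by exact: (measurableT_comp mk mid).
have mW : measurable (W : set cT) by rewrite -(setDUK UW); exact: measurableU.
have mkW : measurable_fun (W : set cT) k by exact: measurable_funTS.
have kgW : ae_eq (lebesgue_tuple R n) (W : set cT) k g.
  exists (W `\` U); split => // x /= /not_implyP[Wx kgx]; split => // Ux.
  by apply: kgx; exact: kg.
have mgW : measurable_fun (W : set cT) g.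
  apply: ae_measurable_fun kgW mkW; exact: measure_is_complete_caratheodory.
rewrite -(ge0_ae_eq_integral mW mkW mgW (fun x _ => k0 x) (fun x _ => g0 x) kgW).
rewrite (ge0_negligible_integral mN mW mkW (fun x _ => k0 x) WU0).
rewrite setDD (setIidr UW).
transitivity (\int[pushforward (lebesgue_tuple R n) (id : cT -> n.-tuple RT)]_(x in U) k x).
  rewrite ge0_integral_pushforward//; first exact: measurable_funTS.
rewrite [RHS](_ : _ = \int[lebesgue_prod R n]_(x in U) k x).
  apply: eq_measure_integral => A mA _; exact: lebesgue_tuple_measurable.
rewrite [RHS]integral_mkcond; apply: eq_integral => x _.
by rewrite patchE; case: ifPn => // /negP xU; apply: kU => Ux; apply: xU; rewrite inE.
Qed.

End Completion.

(** * Real points of the complex ball and the Chebyshev inequality *)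

Section RealPoints.
Context {R : realType} {n : nat}.
Local Notation RT := (measurableTypeR R).
Local Notation mu := (@lebesgue_measure R).
Local Notation normc := (@ComplexField.Normc.normc R).
Implicit Types (x y : n.-tuple R) (V : set 'rV[R]_n) (f : 'rV[R[i]]_n -> R[i]).

Definition complex_point x : 'rV[R[i]]_n := rV_complex (rV_of_tuple x).

Lemma complex_pointE x i : complex_point x 0 i = (tnth x i)%:C.
Proof. by rewrite !mxE. Qed.

Lemma normc_real (a : R) : normc a%:C = `|a|.
Proof. by rewrite /= expr0n addr0 sqrtr_sqr. Qed.

Lemma ler_dist_normc (z w : R[i]) : `|normc z - normc w| <= normc (z - w).
Proof.
have tri (u v : R[i]) : normc (u + v) <= normc u + normc v by exact: le_normcD.
rewrite ler_norml; apply/andP; split.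
  by have := tri (w - z) z; rewrite subrK -(opprB z) (normcN (z - w)); lra.
by have := tri (z - w) w; rewrite subrK; lra.
Qed.

Lemma complex_modulus_continuous f r x : holomorphic_on_ball r f ->
  cball r (complex_point x) -> forall e, 0 < e ->
  exists2 d, 0 < d & forall y, (forall i, `|tnth x i - tnth y i| < d) ->
    `|normc (f (complex_point x)) - normc (f (complex_point y))| < e.
Proof.
move=> fh xr e e0.
have /differentiable_continuous/cvgrPdist_lt := fh _ xr.
have e0' : 0 < e%:C :> R[i] by rewrite ltcR.
move=> /(_ _ e0') /nbhs_ballP[d /= d0 hd].
move: d0; rewrite ltcE/= => /andP[/eqP d_im d_re].
have dE : d = (complex.Re d)%:C by case: d d_im {hd d_re} => a b /= ->.
exists (complex.Re d) => // y xy.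
apply: le_lt_trans (ler_dist_normc _ _) _.
rewrite -ltcR; apply: hd; split; first by rewrite dE ltcR.
move=> i j; rewrite ord1 !complex_pointE dE /ball/= -rmorphB/=.
by rewrite normc_def/= expr0n addr0 sqrtr_sqr ltcR.
Qed.

Lemma interior_tuple V x : V° (rV_of_tuple x) ->
  exists2 d, 0 < d & forall y, (forall i, `|tnth x i - tnth y i| < d) -> V (rV_of_tuple y).
Proof.
move=> /nbhs_ballP[d /= d0 hd]; exists d => // y xy; apply: hd; split => // i j.
by rewrite /ball/= !mxE.
Qed.

Lemma tuple_interior V x d : 0 < d ->
  (forall y, (forall i, `|tnth x i - tnth y i| < d) -> V (rV_of_tuple y)) ->
  V° (rV_of_tuple x).
Proof.
move=> d0 hd; apply/nbhs_ballP; exists d => //= w [_ xw].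
have -> : w = rV_of_tuple [tuple w 0 i | i < n].
  by apply/rowP => i; rewrite mxE tnth_mktuple.
by apply: hd => i; have := xw 0 i; rewrite /ball/= mxE tnth_mktuple.
Qed.

Lemma interior_tuple_open V x : V° (rV_of_tuple x) ->
  exists2 d, 0 < d & forall y, (forall i, `|tnth x i - tnth y i| < d) -> V° (rV_of_tuple y).
Proof.
move=> /(open_interior V)/nbhs_ballP[d /= d0 hd]; exists d => // y xy; apply: hd; split => // i j.
by rewrite /ball/= !mxE.
Qed.

Lemma convex_set_lerp V x y t : convex_set V -> 0 <= t <= 1 ->
  V (rV_of_tuple x) -> V (rV_of_tuple y) -> V (rV_of_tuple (lerp_tuple t x y)).
Proof.
move=> cV /andP[t0 t1] Vx Vy.
have := cV (rV_of_tuple y) (rV_of_tuple x) (Itv01 t0 t1).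
rewrite !inE => /(_ Vy Vx); rewrite /conv/= /unstable.onem.
congr V; apply/rowP => i; rewrite !mxE tnth_mktuple /lerp; ring.
Qed.

(** A neighbour z of (1 - t) x + t y is (1 - t) x + t w for a point w whose distance
    to y is larger by a factor 1 / t only. *)
Lemma convex_lerp_interior V x y t : convex_set V -> 0 < t <= 1 ->
  V (rV_of_tuple x) -> V° (rV_of_tuple y) -> V° (rV_of_tuple (lerp_tuple t x y)).
Proof.
move=> cV /andP[t0 t1] Vx /interior_tuple[d d0 hd].
apply: (@tuple_interior _ _ (t * d)); first by rewrite mulr_gt0.
move=> z hz.
pose w : n.-tuple R := [tuple tnth y i + t^-1 * (tnth z i - lerp t (tnth x i) (tnth y i)) | i < n].
have -> : z = lerp_tuple t x w.
  apply: eq_from_tnth => i; rewrite !tnth_mktuple /lerp; field; lra.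
apply: convex_set_lerp => //; first by rewrite ltW.
apply: hd => i; rewrite tnth_mktuple opprD addrA subrr add0r normrN normrM.
rewrite gtr0_norm ?invr_gt0// mulrC ltr_pdivrMr// distrC mulrC.
by have := hz i; rewrite tnth_mktuple.
Qed.

Lemma cball1_coord x i : cball 1 (complex_point x) -> -1 <= tnth x i < 1.
Proof.
rewrite /cball/= /euclid_norm => x1.
have : `|tnth x i| < 1.
  apply: le_lt_trans x1; rewrite -sqrtr_sqr ler_wsqrtr// (bigD1 i)//=.
  rewrite complex_pointE normc_real real_normK ?num_real// lerDl.
  by apply: sumr_ge0 => j _; rewrite sqr_ge0.
by rewrite ltr_norml => /andP[h ->]; rewrite ltW.
Qed.

Lemma euclid_normZ (a : R) (z : 'rV[R[i]]_n) : 0 <= a ->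
  euclid_norm (a%:C *: z) = a * euclid_norm z.
Proof.
move=> a0; rewrite /euclid_norm -[a in RHS]ger0_norm// -sqrtr_sqr -sqrtrM ?sqr_ge0//.
rewrite mulr_sumr; congr Num.sqrt; apply: eq_bigr => i _.
by rewrite mxE ComplexField.Normc.normcM normc_real exprMn real_normK ?num_real.
Qed.

Lemma euclid_dist0 x y :
  euclid_norm (complex_point y - complex_point x) = 0 -> x = y.
Proof.
move=> /eqP; rewrite sqrtr_eq0 => le0; apply: eq_from_tnth => i.
have : normc ((complex_point y - complex_point x) 0 i) ^+ 2 <= 0.
  apply: le_trans le0; rewrite [leRHS](bigD1 i)//= lerDl.
  by apply: sumr_ge0 => j _; rewrite sqr_ge0.
have -> : (complex_point y - complex_point x) 0 i = (tnth y i - tnth x i)%:C.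
  by rewrite !mxE rmorphB.
rewrite normc_real real_normK ?num_real// => h.
have : (tnth y i - tnth x i) ^+ 2 == 0 by rewrite eq_le h sqr_ge0.
by rewrite sqrf_eq0 subr_eq0 => /eqP.
Qed.

Lemma line_at_lerp (l tau : R) x y : l != 0 ->
  line_at (complex_point x) ((l^-1)%:C *: (complex_point y - complex_point x)) tau =
  complex_point (lerp_tuple (tau / l) x y).
Proof.
move=> l0; apply/rowP => i; rewrite complex_pointE tnth_mktuple !mxE.
rewrite -!rmorphB -!rmorphM -rmorphD/=; congr (_%:C); rewrite /lerp; ring.
Qed.

(** If the exceptional set had length b > 1 / (4 s), the Chebyshev inequality on the
    whole segment would give |f(x)| <= (4 / b)^d |f(x)| / L, although
    (4 / b)^d < (16 s)^(m + 1) = L.  The segment is parametrized by arc length in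
    the Chebyshev inequality, hence the factor l between the two lengths. *)
Lemma chebyshev_segment f (d : R) (m s : nat) x y :
  let L := (16 * s%:R) ^+ m.+1 in
  let bad := [set t | 0 <= t <= 1 /\
    normc (f (complex_point (lerp_tuple t x y))) < normc (f (complex_point x)) / L] in
  (0 < s)%N -> 0 < d <= m.+1%:R -> chebyshev_ineq f d ->
  (forall t, 0 <= t <= 1 -> cball 1 (complex_point (lerp_tuple t x y))) ->
  0 < normc (f (complex_point x)) -> measurable (bad : set RT) ->
  (mu bad <= ((4 * s%:R)^-1)%:E)%E.
Proof.
move=> L bad s0 /andP[d0 dm] chf seg gx0 mbad.
have s1 : 1 <= s%:R :> R by rewrite ler1n.
have L1 : 1 <= L by rewrite exprn_ege1//; lra.
pose l := euclid_norm (complex_point y - complex_point x).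
have x0E := lerp_tuple0 x y.
have x1 : cball 1 (complex_point x) by rewrite -x0E; apply: seg; rewrite lexx ler01.
(* A degenerate segment has no direction, but then the set is empty. *)
have [l0|l_ne0] := eqVneq l 0.
  rewrite (_ : bad = set0) ?measure0 ?lee_fin ?invr_ge0 ?mulr_ge0//.
  apply/seteqP; split => // t [_]; rewrite -(euclid_dist0 l0).
  by rewrite lerp_tuplexx ltNge ler_pdivrMr ?ler_peMr// ?ltW// (lt_le_trans ltr01).
have l0 : 0 < l by rewrite lt_neqAle eq_sym l_ne0 sqrtr_ge0.
rewrite leNgt; apply/negP => bad_gt.
have bad01 : bad `<=` `[0, 1]%classic by move=> t [t01 _]; rewrite /= in_itv.
have bad_le1 : (mu bad <= 1)%E.
  have -> : 1%E = mu `[0, 1]%classic.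
    by rewrite lebesgue_measure_itv/= lte_fin ltr01 oppr0 adde0.
  by apply: le_measure; rewrite ?inE//.
have badfin : mu bad \is a fin_num.
  by rewrite ge0_fin_numE//; apply: le_lt_trans bad_le1 (ltry _).
pose b := fine (mu bad).
have bE : mu bad = b%:E by rewrite fineK.
have b_gt : (4 * s%:R)^-1 < b by rewrite -lte_fin -bE.
have b1 : b <= 1 by rewrite -lee_fin -bE.
have b0 : 0 < b by apply: lt_trans b_gt; rewrite invr_gt0 mulr_gt0//; lra.
pose I : set R := `[0, l]%classic.
pose om : set R := (fun u : R => l^-1 * u + 0) @^-1` bad.
have l10 : 0 < l^-1 by rewrite invr_gt0.
have mom : measurable (om : set RT).
  by rewrite -[X in measurable X]setTI; apply: (measurable_affine l^-1 0).
have omE : mu om = (l * b)%:E.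
  have := lebesgue_measure_affine 0 l10 mbad; rewrite -/om bE => h.
  by rewrite EFinM h muleA -EFinM divff// mul1e.
have IE : mu I = l%:E by rewrite lebesgue_measure_itv/= lte_fin l0 oppr0 adde0.
pose v := (l^-1)%:C *: (complex_point y - complex_point x).
have v1 : euclid_norm v = 1 by rewrite euclid_normZ ?ltW// mulVf.
have lineE tau : line_at (complex_point x) v tau = complex_point (lerp_tuple (tau / l) x y).
  exact: line_at_lerp.
have Iin tau : I tau -> 0 <= tau / l <= 1.
  by rewrite /I/= in_itv/= => /andP[t0 t1]; rewrite divr_ge0 ?(ltW l0)//= ler_pdivrMr// mul1r.
have omI : om `<=` I.
  move=> tau [] /=; rewrite addr0 [_^-1 * _]mulrC => /andP[t0 t1] _.
  rewrite /I/= in_itv/=; move: t0 t1; rewrite ler_pdivrMr// mul1r => + ->.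
  by rewrite pmulr_lge0// => ->.
have := chf (complex_point x) v x1 v1 I om.
have iI : is_interval I by exact: interval_is_interval.
have Icball : line_at (complex_point x) v @` I `<=` cball 1.
  by move=> _ [tau It <-]; rewrite lineE; apply/seg/Iin.
have mcom : (wlength idfun)^*%mu.-cara.-measurable om.
  exact: sub_caratheodory.
have omgt : (0 < @completed_lebesgue_measure R om)%E.
  by rewrite [X in (_ < X)%E]omE lte_fin mulr_gt0.
move=> /(_ iI Icball mcom omI omgt).
rewrite [X in 4 * fine X](_ : _ = l%:E)// [X in _ / fine X](_ : _ = (l * b)%:E)//=.
set K := _ `^ d => cheb.
have lower : ((normc (f (complex_point x)))%:E <=
    sup_norm (line_at (complex_point x) v @` I) f)%E.
  apply: ereal_sup_ubound; exists (complex_point x) => //; exists 0.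
    by rewrite /I/= in_itv/= lexx ltW.
  by rewrite lineE mul0r x0E.
have upper : (sup_norm (line_at (complex_point x) v @` om) f <=
    (normc (f (complex_point x)) / L)%:E)%E.
  apply: ge_ereal_sup => _ [_ [tau omt <-] <-]; rewrite lineE lee_fin ltW//.
  by case: omt; rewrite /= addr0 [_^-1 * _]mulrC.
have : ((normc (f (complex_point x)))%:E <= (K * (normc (f (complex_point x)) / L))%:E)%E.
  apply: (le_trans lower); apply: (le_trans cheb); rewrite EFinM.
  by apply: lee_wpmul2l => //; rewrite lee_fin powR_ge0.
rewrite lee_fin mulrA ler_pdivlMr ?(lt_le_trans ltr01)// mulrC ler_pM2r//.
apply/negP; rewrite -ltNge /K.
have -> : 4 * l / (l * b) = 4 / b by field; rewrite !gt_eqF.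
have b4 : 1 <= 4 / b by rewrite ler_pdivlMr// mul1r; lra.
apply: (le_lt_trans (ler_powR b4 dm)).
rewrite powR_mulrn ?(le_trans ler01)// /L ltr_pXn2r//; last 2 first.
- by rewrite nnegrE (le_trans ler01).
- by rewrite nnegrE mulr_ge0.
rewrite ltr_pdivrMr//.
have : 4 * s%:R * (4 * s%:R)^-1 = 1 :> R by rewrite divff// gt_eqF//; lra.
have : 4 * s%:R * (4 * s%:R)^-1 < 4 * s%:R * b by rewrite ltr_pM2l//; lra.
lra.
Qed.

End RealPoints.

(** * The reverse Hölder inequality on convex bodies *)

Section ConvexBodies.
Context {R : realType} {n : nat}.
Local Notation RT := (measurableTypeR R).
Local Notation mu := (@lebesgue_measure R).
Local Notation normc := (@ComplexField.Normc.normc R).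

(** The restriction can only jump downwards when leaving the open set U. *)
Lemma lsc_restrict (g : n.-tuple R -> R) (U : set (n.-tuple R)) :
  (forall x, 0 <= g x) ->
  (forall x, U x -> exists2 d, 0 < d &
    forall y, (forall i, `|tnth x i - tnth y i| < d) -> U y) ->
  (forall x, U x -> forall e, 0 < e -> exists2 d, 0 < d &
    forall y, (forall i, `|tnth x i - tnth y i| < d) -> `|g x - g y| < e) ->
  lsc_tuple (fun x => g x * \1_U x).
Proof.
move=> g0 Uo gc x y; rewrite indicE; case: (boolP (x \in U)) => [|_]; last first.
  rewrite mulr0 => y0; exists 1 => // x' _.
  by apply: lt_le_trans y0 _; rewrite mulr_ge0.
rewrite inE mulr1 => Ux ygx.
have [d1 d10 h1] := Uo x Ux.
have [d2 d20 h2] := gc x Ux (g x - y) ltac:(by rewrite subr_gt0).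
exists (Num.min d1 d2); first by rewrite lt_min d10.
move=> x' hx'; rewrite indicE mem_set ?mulr1; last first.
  by apply: h1 => i; have := hx' i; rewrite lt_min => /andP[].
have := h2 x' (fun i => ltac:(by have := hx' i; rewrite lt_min => /andP[])).
by rewrite ltr_norml; lra.
Qed.

Lemma lebesgue_prod_box_lty (U : set (n.-tuple R)) :
  measurable (U : set (n.-tuple RT)) ->
  (forall x i, U x -> -1 <= tnth x i < 1) -> (lebesgue_prod R n U < +oo)%E.
Proof.
move=> mU Ubox; pose k : n.-tuple 'I_1 := [tuple ord0 | _ < n].
have mk := measurable_grid_cell (-1 : R) 2 k.
apply: (@le_lt_trans _ _ (lebesgue_prod R n (grid_cell (-1) 2 k))); last first.
  by rewrite lebesgue_prod_grid_cell// ltry.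
apply: le_measure; rewrite ?inE// => x Ux i.
by have := Ubox x i Ux; rewrite tnth_mktuple /= mulr0 addr0; lra.
Qed.

(** [moment_le_of_mean] on the interior of V.  An infinite moment is read as 0 by
    the real-valued average, as are averages over a set of volume 0, so these
    cases are immediate; otherwise the mean is finite as well, because
    phi <= 1 + phi^s.  The mean is enlarged slightly, as it might vanish. *)
Lemma reverse_holder_convex_body (r d : R) (m s : nat) (V : set 'rV[R]_n)
    (f : 'rV[R[i]]_n -> R[i]) :
  (0 < s)%N -> 1 < r -> convex_body V -> rV_complex @` V `<=` cball 1 ->
  holomorphic_on_ball r f -> 0 < d <= m.+1%:R -> chebyshev_ineq f d ->
  average V (fun x => normc (f (rV_complex x)) ^+ s) `^ (s%:R^-1) <=
  (1 + (4 * (16 * s%:R) ^+ m.+1) ^+ (2 * s)) *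
    average V (fun x => normc (f (rV_complex x))).
Proof.
move=> s0 r1 [_ cV [v0 Vv0]] Vball fh dm chf.
pose L : R := (16 * s%:R) ^+ m.+1.
pose C : R := 1 + (4 * L) ^+ (2 * s).
have s1 : 1 <= s%:R :> R by rewrite ler1n.
have L1 : 1 <= L by rewrite exprn_ege1//; lra.
have C1 : 1 <= C by rewrite lerDl exprn_ge0// mulr_ge0// (le_trans ler01).
pose g (x : n.-tuple R) := normc (f (complex_point x)).
pose W : set (n.-tuple RT) := rV_of_tuple @^-1` V.
pose U : set (n.-tuple RT) := rV_of_tuple @^-1` V°.
have UW : U `<=` W by move=> x; exact: interior_subset.
have g0 x : 0 <= g x by rewrite /g; case: (f _) => a b; exact: sqrtr_ge0.
have Wball x : W x -> cball 1 (complex_point x).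
  by move=> Wx; apply: Vball; exists (rV_of_tuple x).
have Wr x : W x -> cball r (complex_point x).
  by move=> /Wball; rewrite /cball/= => /lt_trans; apply.
have Ubox x i : U x -> -1 <= tnth x i < 1.
  by move=> /UW /Wball; exact: cball1_coord.
pose phi (x : n.-tuple R) := g x * \1_U x.
have phi0 x : 0 <= phi x by rewrite mulr_ge0.
have phiE x : U x -> phi x = g x by move=> Ux; rewrite /phi indicE mem_set// mulr1.
have phiN x : ~ U x -> phi x = 0 by move=> Ux; rewrite /phi indicE memNset// mulr0.
have phiU x : phi x != 0 -> U x.
  by move=> px; apply: contrapT => /phiN p0; rewrite p0 eqxx in px.
have Uopen x : U x -> exists2 d, 0 < d &
    forall y, (forall i, `|tnth x i - tnth y i| < d) -> U y.
  exact: interior_tuple_open.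
have lphi : lsc_tuple phi.
  by apply: lsc_restrict => // x Ux; apply: (complex_modulus_continuous fh); exact/Wr/UW.
have lU : lsc_tuple (\1_U : n.-tuple R -> R).
  rewrite (_ : \1_U = fun x : n.-tuple R => 1 * \1_U x); last first.
    by apply/funext => x; rewrite mul1r.
  apply: (@lsc_restrict (fun=> 1)) => // x Ux e e0.
  by exists 1 => // y _; rewrite subrr normr0.
have mU := measurable_lsc_set lU Ubox.
have mU1 := measurable_lsc_indic lU Ubox.
have mphi : measurable_fun setT (fun x : n.-tuple RT => (phi x)%:E).
  by apply: measurable_lsc => // x /phiU Ux i; exact: Ubox.
have Ulty := lebesgue_prod_box_lty mU Ubox.
have Ufin : lebesgue_prod R n U \is a fin_num by rewrite ge0_fin_numE.
pose v := fine (lebesgue_prod R n U).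
have Uv : lebesgue_prod R n U = v%:E by rewrite fineK.
pose x0 : n.-tuple R := [tuple v0 0 i | i < n].
have x0E : rV_of_tuple x0 = v0 by apply/rowP => i; rewrite mxE tnth_mktuple.
have Ux0 : U x0 by rewrite /U/= x0E.
have WU0 : lebesgue_tuple R n (W `\` U) = 0%E.
  apply: (lebesgue_tuple_convex_boundary mU Uv UW (x0 := x0)) => x e Wx /andP[e0 e1].
  by apply: convex_lerp_interior => //; rewrite e0 ltW.
have volE : volume V = v%:E by rewrite -Uv; exact: lebesgue_tuple_null_extension.
have avgE k : (0 < k)%N -> average V (fun x => normc (f (rV_complex x)) ^+ k) =
    v^-1 * fine (\int[lebesgue_prod R n]_x (phi x ^+ k)%:E)%E.
  move=> k0; rewrite /average volE; congr (_ * fine _).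
  apply: (ge0_integral_lebesgue_tuple mU UW WU0).
  - by apply/measurable_EFinP; apply: measurable_funX; exact/measurable_EFinP.
  - by move=> x; rewrite lee_fin; exact/exprn_ge0/g0.
  - by move=> x; rewrite lee_fin exprn_ge0.
  - by move=> x Ux; rewrite phiE.
  - by move=> x nUx; rewrite (phiN x nUx) expr0n eqn0Ngt k0.
have avg1E : average V (fun x => normc (f (rV_complex x))) =
    v^-1 * fine (\int[lebesgue_prod R n]_x (phi x)%:E)%E.
  exact: (avgE 1%N isT).
rewrite avgE// avg1E -/L -/C.
have v_ge0 : 0 <= v by rewrite fine_ge0.
have A0 : (0 <= \int[lebesgue_prod R n]_x (phi x)%:E)%E.
  by apply: integral_ge0 => x _; rewrite lee_fin.
have rhs0 : 0 <= C * (v^-1 * fine (\int[lebesgue_prod R n]_x (phi x)%:E)%E).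
  by rewrite !mulr_ge0 ?invr_ge0 ?fine_ge0// (le_trans ler01).
have sV0 : s%:R^-1 != 0 :> R by rewrite invr_eq0 pnatr_eq0 -lt0n.
have [->|v_ne0] := eqVneq v 0; first by rewrite invr0 !mul0r mulr0 powR0.
have vpos : 0 < v by rewrite lt_neqAle eq_sym v_ne0.
set S := (\int[lebesgue_prod R n]_x (phi x ^+ s)%:E)%E.
have S0 : (0 <= S)%E by apply: integral_ge0 => x _; rewrite lee_fin exprn_ge0.
have [Soo|Slty] := eqVneq S +oo%E; first by rewrite Soo mulr0 powR0.
have Sfin : S \is a fin_num by rewrite ge0_fin_numE// ltey.
have mphis : measurable_fun setT (fun x : n.-tuple RT => (phi x ^+ s)%:E).
  by apply/measurable_EFinP; apply: measurable_funX; exact/measurable_EFinP.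
have Afin : (\int[lebesgue_prod R n]_x (phi x)%:E)%E \is a fin_num.
  rewrite ge0_fin_numE//.
  apply: (@le_lt_trans _ _ (\int[lebesgue_prod R n]_x ((\1_U x : R)%:E + (phi x ^+ s)%:E))%E).
    apply: ge0_le_integral => //.
    - by move=> x _; rewrite lee_fin.
    - exact: emeasurable_funD.
    move=> x _; rewrite -EFinD lee_fin.
    have [phi1|phi1] := leP (phi x) 1.
      have [Ux|/phiN ->] := pselect (U x); last by rewrite addr_ge0// exprn_ge0.
      by rewrite indicE mem_set//; apply: (le_trans phi1); rewrite lerDl exprn_ge0.
    rewrite -[leLHS]add0r lerD// -[leLHS]expr1 ler_weXn2l// ltW//.
  rewrite ge0_integralD//.
  - rewrite integral_indic// setIT; apply: lte_add_pinfty => //.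
    by rewrite -/S ltey.
  - by move=> x _; rewrite lee_fin exprn_ge0.
set A := fine (\int[lebesgue_prod R n]_x (phi x)%:E)%E.
have A_ge0 : 0 <= A by rewrite fine_ge0.
have segU x y t : U x -> U y -> 0 <= t <= 1 -> U (lerp_tuple t x y).
  move=> Ux Uy /andP[t0 t1]; have [->|t_ne0] := eqVneq t 0.
    by rewrite lerp_tuple0.
  apply: convex_lerp_interior => //; last exact: UW.
  by rewrite lt_neqAle eq_sym t_ne0 t0.
have dil x y : U x -> U y -> 0 < phi x ->
    (mu [set t | (0 <= t <= 1)%R /\ (phi (lerp_tuple t x y) < phi x / L)%R] <=
      ((4 * s%:R)^-1)%:E)%E.
  move=> Ux Uy phix.
  have badE : [set t | (0 <= t <= 1)%R /\ (phi (lerp_tuple t x y) < phi x / L)%R] =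
      [set t | 0 <= t <= 1 /\ g (lerp_tuple t x y) < g x / L].
    apply/seteqP; split => t [t01].
      by rewrite (phiE _ (segU _ _ _ Ux Uy t01)) (phiE _ Ux).
    by rewrite -(phiE _ (segU _ _ _ Ux Uy t01)) -(phiE _ Ux).
  have mbad : measurable ([set t : R | 0 <= t <= 1 /\ g (lerp_tuple t x y) < g x / L] : set RT).
    by rewrite -badE; exact: measurable_segment_sublevel.
  rewrite badE; apply: (chebyshev_segment s0 dm chf) => //.
  - by move=> t t01; apply/Wball/UW; exact: segU.
  - by rewrite -[normc _]/(g x) -phiE.
(* The mean A is replaced by a positive number larger by v e / C. *)
apply/ler_addgt0Pr => e e0.
have C0 : 0 < C := lt_le_trans ltr01 C1.
pose A' := A + v * e / C.
have A'0 : 0 < A' by rewrite ltr_wpDl// divr_gt0// mulr_gt0.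
have phiA' : (\int[lebesgue_prod R n]_x (phi x)%:E <= A'%:E)%E.
  by rewrite -(fineK Afin) lee_fin lerDl divr_ge0 ?mulr_ge0 ?ltW.
have := moment_le_of_mean s0 L1 vpos A'0 phi0 phiU lphi lU Ubox dil Uv phiA'.
rewrite -/S -(fineK Sfin) lee_fin -/C => SC.
have Av0 : 0 <= A' / v by rewrite divr_ge0 ?ltW.
have -> : C * (v^-1 * A) + e = C * (A' / v).
  by rewrite /A'; field; rewrite !gt_eqF.
have le1 : v^-1 * fine S <= C * (A' / v) ^+ s by rewrite mulrC ler_pdivrMr.
apply: (@le_trans _ _ ((C * (A' / v) ^+ s) `^ (s%:R^-1))).
  have l0 : 0 <= v^-1 * fine S by rewrite mulr_ge0 ?invr_ge0 ?fine_ge0.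
  have sV_ge0 : 0 <= s%:R^-1 :> R by rewrite invr_ge0.
  exact: (ge0_ler_powR sV_ge0 l0 (le_trans l0 le1) le1).
rewrite powRM ?(ltW C0) ?exprn_ge0// -(powR_mulrn s Av0) -powRrM mulfV ?powRr1//; last first.
  by rewrite pnatr_eq0 -lt0n.
rewrite ler_wpM2r// -[leRHS]powRr1 ?(ltW C0)//.
by rewrite ler_powR// invf_le1//; lra.
Qed.

End ConvexBodies.

Theorem corollary1p13 (R : realType) :
  exists c : nat -> nat -> R,
    (forall m s : nat, (0 < s)%N -> 0 < c m s) /\
    forall (m s n : nat) (r : R) (V : set 'rV[R]_n) (f : 'rV[R[i]]_n -> R[i]),
      (0 < s)%N -> (0 < n)%N -> 1 < r ->
      convex_body V -> rV_complex @` V `<=` cball 1 ->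
      holomorphic_on_ball r f ->
      is_smallest_int_ge (chebyshev_degree f) m%:Z ->
      average V (fun x => ComplexField.Normc.normc (f (rV_complex x)) ^+ s)
        `^ (s%:R^-1)
      <= c m s * average V (fun x => ComplexField.Normc.normc (f (rV_complex x))).
Proof.
exists (fun m s => 1 + (4 * (16 * s%:R) ^+ m.+1) ^+ (2 * s)); split.
  by move=> m s s0; rewrite ltr_wpDr// exprn_ge0// mulr_ge0// exprn_ge0// mulr_ge0.
move=> m s n r V f s0 _ r1 Vbody Vball fh [dm _].
(* The degree is an infimum: some exponent d < m + 1 is admissible. *)
have : (chebyshev_degree f < (m.+1%:R)%:E)%E.
  by apply: le_lt_trans dm _; rewrite lte_fin -pmulrn ltr_nat.
move=> /ereal_inf_lt[_ [d [d0 chf] <-]]; rewrite lte_fin => /ltW dm1.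
by apply: (@reverse_holder_convex_body R n r d) => //; rewrite d0.
Qed.
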